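(* There is an algorithm that, given a QBF $\varphi=Q_1S_1\dots\forall S_{\ell-1}\exists S_\ell.\,\psi$ and a tree decomposition of width $k$ of its primal graph $G_\varphi$, outputs in time $O^*(2^k)$ a QBF $\varphi'=Q_1S_1\dots\forall S'_{\ell-1}.\,\psi'$ (with the blocks before $S_{\ell-1}$ unchanged) and a tree decomposition of width $12\cdot 2^k$ of $G_{\varphi'}$ such that $\varphi$ is valid if and only if $\varphi'$ is valid.
   Context: QBFs are fully quantified and in prenex normal form, $Q_1S_1\dots Q_\ell S_\ell.\,\psi$, where the $S_i$ are disjoint sets of propositional variables, $Q_i\in\{\exists,\forall\}$, and the quantifier-free matrix $\psi$ is a CNF if the innermost quantifier is existential and a DNF if it is universal. So here $\psi$ is a CNF and $\psi'$ is a DNF. A QBF is valid if it evaluates to true. The primal graph $G_\varphi$ has as vertices the variables of the matrix, with an edge between two variables occurring together in a clause (or term). The width of a tree decomposition is the maximum bag size minus one. $O^*(\cdot)$ hides factors polynomial in the input size. *)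

(* Defs.v *)
From HB Require Import structures.
From mathcomp Require Import all_boot.

Set Implicit Arguments.
Unset Strict Implicit.
Unset Printing Implicit Defensive.

(** * Quantified Boolean formulas *)

(* Propositional variables are named by binary words, so that formulas are
   objects over a finite alphabet and the length of a name counts towards the
   size of the input. *)
Definition pvar := seq bool.

Definition assignment := pvar -> bool.

(* [(x, true)] is the literal x and [(x, false)] its negation. *)
Definition literal := (pvar * bool)%type.

(* The list of clauses of a CNF, or the list of terms of a DNF. *)
Definition matrix := seq (seq literal).

Inductive quantifier := Ex | All.

(* A quantifier and the set of variables it binds, listed without repetition. *)
Definition block := (quantifier * seq pvar)%type.

Record qbf := Qbf { prefix : seq block; body : matrix }.

Definition lit_true (tau : assignment) (l : literal) : bool := tau l.1 == l.2.

Definition cnf_true (tau : assignment) (M : matrix) : bool :=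
  all (has (lit_true tau)) M.

Definition dnf_true (tau : assignment) (M : matrix) : bool :=
  has (all (lit_true tau)) M.

Definition innermost (P : seq block) : quantifier := last Ex (map fst P).

Definition matrix_true (phi : qbf) (tau : assignment) : bool :=
  match innermost (prefix phi) with
  | Ex => cnf_true tau (body phi)
  | All => dnf_true tau (body phi)
  end.

Definition update (tau : assignment) (x : pvar) (b : bool) : assignment :=
  fun y => if y == x then b else tau y.

Fixpoint quantify (q : quantifier) (X : seq pvar) (F : assignment -> bool)
    (tau : assignment) : bool :=
  if X is x :: X' then
    let branch b := quantify q X' F (update tau x b) in
    match q with
    | Ex => branch true || branch false
    | All => branch true && branch false
    end
  else F tau.

Fixpoint eval_prefix (P : seq block) (F : assignment -> bool)
    (tau : assignment) : bool :=
  if P is (q, X) :: P' then quantify q X (eval_prefix P' F) tau else F tau.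

(* The starting assignment is irrelevant for well-formed formulas, which have
   no free variables. *)
Definition valid (phi : qbf) : bool :=
  eval_prefix (prefix phi) (matrix_true phi) (fun => false).

Definition clause_vars (C : seq literal) : seq pvar := map fst C.

Definition matrix_vars (M : matrix) : seq pvar := flatten (map clause_vars M).

Definition bound_vars (P : seq block) : seq pvar := flatten (map snd P).

(* The blocks are pairwise disjoint and every variable is quantified. *)
Definition wf_qbf (phi : qbf) : Prop :=
  uniq (bound_vars (prefix phi)) /\
  {subset matrix_vars (body phi) <= bound_vars (prefix phi)}.

(** * Primal graphs and tree decompositions *)

Definition primal_vertices (phi : qbf) : pred pvar :=
  fun x => x \in matrix_vars (body phi).

Definition primal_edge (phi : qbf) : rel pvar :=
  fun x y => (x != y) &&
    has (fun C => (x \in clause_vars C) && (y \in clause_vars C)) (body phi).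

(* A finite rooted tree whose nodes are labelled by bags. *)
Inductive btree := BNode (bag : seq pvar) (children : seq btree).

Definition root_bag (D : btree) : seq pvar := let: BNode b _ := D in b.

Definition children (D : btree) : seq btree := let: BNode _ Ds := D in Ds.

Fixpoint bags (D : btree) : seq (seq pvar) :=
  let: BNode b Ds := D in b :: flatten (map bags Ds).

(* Nodes are addressed by the sequence of child indices leading to them from
   the root. *)
Definition position := seq nat.

Fixpoint subtree_at (D : btree) (p : position) : option btree :=
  if p is i :: p' then
    if onth (children D) i is Some D' then subtree_at D' p' else None
  else Some D.

Definition in_bag_at (D : btree) (x : pvar) (p : position) : bool :=
  if subtree_at D p is Some D' then x \in root_bag D' else false.

Definition is_child (p q : position) : bool := q == rcons p (last 0 q).

Definition tree_adj : rel position := fun p q => is_child p q || is_child q p.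

Definition is_tree_decomposition (V : pred pvar) (E : rel pvar) (D : btree)
    : Prop :=
  [/\ forall b, b \in bags D -> uniq b /\ {subset b <= V},
      forall x, V x -> exists2 b, b \in bags D & x \in b,
      forall x y, V x -> V y -> E x y ->
        exists2 b, b \in bags D & (x \in b) && (y \in b)
    & forall x p q, in_bag_at D x p -> in_bag_at D x q ->
        exists s : seq position,
          [/\ path tree_adj p s, last p s = q & all (in_bag_at D x) s]].

(* The subtraction is truncated: if all bags are empty, the width is 0. *)
Definition width (D : btree) : nat := (\max_(b <- bags D) size b).-1.

Definition tree_decomposition_of (phi : qbf) (D : btree) : Prop :=
  is_tree_decomposition (primal_vertices phi) (primal_edge phi) D.

(** * Algorithms and running time *)

(* Programs are written in a first-order call-by-value language of recursive
   functions over binary trees (pure LISP without atoms other than nil).  One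
   step is a constant number of pointer operations; up to factors polynomial in
   the logarithm of the running time and in the input size, time on this machine
   agrees with time on a random-access machine. *)
Inductive data := Nil | Cons (a d : data).

(* Variables are de Bruijn indices.  [Case e e1 e2] continues with [e1] if [e]
   is nil; otherwise with [e2], where index 0 is the left and index 1 the right
   component of the value of [e].  [Call f e] calls the [f]-th function of the
   program, whose only variable in scope is its argument. *)
Inductive expr :=
  | Var (i : nat)
  | Empty
  | Pair (e1 e2 : expr)
  | Case (e e1 e2 : expr)
  | Let (e1 e2 : expr)
  | Call (f : nat) (e : expr).

(* The list of function bodies; the function of index 0 is the entry point. *)
Definition program := seq expr.

(* [eval P env e v t]: in environment [env], expression [e] of program [P]
   evaluates to [v] in exactly [t] steps. *)
Inductive eval (P : program) : seq data -> expr -> data -> nat -> Prop :=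
  | eval_var env i : eval P env (Var i) (nth Nil env i) 1
  | eval_empty env : eval P env Empty Nil 1
  | eval_pair env e1 e2 v1 v2 t1 t2 :
      eval P env e1 v1 t1 -> eval P env e2 v2 t2 ->
      eval P env (Pair e1 e2) (Cons v1 v2) (t1 + t2).+1
  | eval_case_nil env e e1 e2 v t t1 :
      eval P env e Nil t -> eval P env e1 v t1 ->
      eval P env (Case e e1 e2) v (t + t1).+1
  | eval_case_cons env e e1 e2 a d v t t2 :
      eval P env e (Cons a d) t -> eval P [:: a, d & env] e2 v t2 ->
      eval P env (Case e e1 e2) v (t + t2).+1
  | eval_let env e1 e2 v1 v t1 t2 :
      eval P env e1 v1 t1 -> eval P (v1 :: env) e2 v t2 ->
      eval P env (Let e1 e2) v (t1 + t2).+1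
  | eval_call env f e v1 v t1 t2 :
      eval P env e v1 t1 -> eval P [:: v1] (nth Empty P f) v t2 ->
      eval P env (Call f e) v (t1 + t2).+1.

(* The number of symbols needed to write a tree down, without sharing. *)
Fixpoint dsize (v : data) : nat :=
  if v is Cons a d then (dsize a + dsize d).+1 else 1.

(* The size of the output is part of the running time.  Values may share
   subtrees in memory, so it is not bounded by the number of steps. *)
Definition outputs_in_time (P : program) (input output : data) (t : nat)
    : Prop :=
  exists2 s, eval P [:: input] (nth Empty P 0) output s & t = s + dsize output.

(** * Encodings *)

Definition enc_seq (T : Type) (enc : T -> data) (s : seq T) : data :=
  foldr (fun x => Cons (enc x)) Nil s.

Definition enc_bool (b : bool) : data := if b then Cons Nil Nil else Nil.

Definition enc_pvar (x : pvar) : data := enc_seq enc_bool x.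

Definition enc_literal (l : literal) : data :=
  Cons (enc_pvar l.1) (enc_bool l.2).

Definition enc_matrix (M : matrix) : data := enc_seq (enc_seq enc_literal) M.

Definition enc_quantifier (q : quantifier) : data :=
  enc_bool (if q is All then true else false).

Definition enc_block (B : block) : data :=
  Cons (enc_quantifier B.1) (enc_seq enc_pvar B.2).

Definition enc_qbf (phi : qbf) : data :=
  Cons (enc_seq enc_block (prefix phi)) (enc_matrix (body phi)).

Fixpoint enc_btree (D : btree) : data :=
  let: BNode b Ds := D in
  Cons (enc_seq enc_pvar b) (enc_seq enc_btree Ds).

Definition encode (phi : qbf) (D : btree) : data :=
  Cons (enc_qbf phi) (enc_btree D).

(* Main.v *)
(** Dynamic programming over the tree decomposition decides [exists S2. psi].
    For the node at path [pi], with the bag [p] of its parent, and for each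
    assignment [a] of [p], a universal variable [s_(pi, a)] stands for "[a]
    extends to a solution of the clauses below", and [r_(pi, g)] for the same
    with [a] restricted to the variables shared with the first subtree.  Each
    term of the DNF refutes one implication of the recursion, and one more term
    is the literal [s] of the root.  If [psi] has a solution, a choice that
    refutes all other terms makes [s] true along the solution, up to the root;
    if not, the exact values of the recursion falsify every term.  In the
    left-child right-sibling form of the tree, the variables of an implication
    fit into one bag with at most four families of [2 ^ (k + 1)] new variables
    and the [2 * (k + 1)] variables of two old bags. *)

Require Import Defs.
From HB Require Import structures.
From mathcomp Require Import all_boot zify.
Import Defs.

Set Implicit Arguments.
Unset Strict Implicit.
Unset Printing Implicit Defensive.

(** * Forests *)

(** The intermediate variables [r] keep the number of terms per node at [O(2 ^ k)]. Linking [s] of a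
    parent directly with [s] of a child would take one term for every compatible pair of
    assignments, a number exponential in the size of the union of both bags; projecting to the
    shared variables first takes one term for each assignment of either bag. The binary form bounds
    the number of premises of an implication, whatever the number of children. No clause is attached
    to a node. An assignment of a bag is tested against all clauses, literals outside the bag
    counting as true; nothing is lost, since by the Helly property of subtrees every clause lies
    inside some bag. The values of [S2] survive only in the indices of the new variables. The
    remaining old variables enter the terms as literals, so they stay in the new bags and their
    connectivity has to be carried over to the binary tree. The names of new variables must be
    actual binary words, short enough to be written in polynomial time and distinct from all old
    names. Since time includes the output written without sharing, its size is bounded separately
    from the number of steps. *)

(* Left-child right-sibling form of a list of trees: [Br b L1 L2] is the list
   that starts with the tree of bag [b] and children [L1] and goes on as [L2]. *)
Inductive forest := Leaf | Br (b : seq pvar) (L1 L2 : forest).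

Lemma forest_eq_dec : comparable forest.
Proof.
elim=> [|b L1 IH1 L2 IH2] [|b' L1' L2']; try by [left | right].
have [<-|neb] := eqVneq b b'; last by right=> -[] /eqP; rewrite (negbTE neb).
case: (IH1 L1') => [<-|ne1]; last by right=> -[].
by case: (IH2 L2') => [<-|ne2]; [left | right=> -[]].
Qed.
HB.instance Definition _ := hasDecEq.Build forest (compareP forest_eq_dec).

Lemma data_eq_dec : comparable data.
Proof.
elim=> [|a IHa d IHd] [|a' d']; try by [left | right].
case: (IHa a') => [<-|nea]; last by right=> -[].
by case: (IHd d') => [<-|ned]; [left | right=> -[]].
Qed.
HB.instance Definition _ := hasDecEq.Build data (compareP data_eq_dec).

Fixpoint lcrs (D : btree) (rest : forest) : forest :=
  let: BNode b Ds := D in Br b (foldr lcrs Leaf Ds) rest.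

Fixpoint enc_forest (F : forest) : data :=
  if F is Br b L1 L2 then
    Cons (Cons (enc_seq enc_pvar b) (enc_forest L1)) (enc_forest L2)
  else Nil.

Fixpoint fbags (F : forest) : seq (seq pvar) :=
  if F is Br b L1 L2 then b :: fbags L1 ++ fbags L2 else [::].

Definition fvars (F : forest) : seq pvar := flatten (fbags F).

(* The part of the connectivity condition on [F] that can be seen locally;
   [p] is the bag of the parent of the roots. *)
Fixpoint connected_below (p : seq pvar) (F : forest) : Prop :=
  if F is Br b L1 L2 then
    [/\ connected_below b L1, connected_below p L2,
        forall x, x \in b ++ fvars L1 -> x \in p -> x \in b
      & forall x, x \in b ++ fvars L1 -> x \in fvars L2 -> x \in p]
  else True.

Lemma fvarsP x F : reflect (exists2 b, b \in fbags F & x \in b) (x \in fvars F).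
Proof. exact: flattenP. Qed.

Lemma fvars_Br b L1 L2 x :
  (x \in fvars (Br b L1 L2)) = (x \in b ++ fvars L1) || (x \in fvars L2).
Proof. by rewrite /fvars /= flatten_cat !mem_cat orbA. Qed.

(** The automatic principle gives no hypothesis for the trees inside the list of children. A [foldr]
    of conjunctions supplies it and unfolds along the list by computation. *)
Lemma btree_ind_nested (Q : btree -> Prop) :
  (forall b Ds, foldr (fun D => and (Q D)) True Ds -> Q (BNode b Ds)) ->
  forall D, Q D.
Proof.
move=> QN; fix IH 1 => -[b Ds]; apply: QN.
by elim: Ds => [|D Ds IHDs]; [exact: I | exact: conj (IH D) IHDs].
Qed.

(** A list is encoded by right-nested pairs, which is already the left-child right-sibling form. The
    program therefore reads the input tree as a forest without converting it. *)
Lemma enc_forest_lcrs D rest :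
  enc_forest (lcrs D rest) = Cons (enc_btree D) (enc_forest rest).
Proof.
elim/btree_ind_nested: D rest => b Ds /= IH rest; congr (Cons (Cons _ _) _).
by elim: Ds IH => //= D Ds IHDs [-> /IHDs ->].
Qed.

Lemma fbags_lcrs D rest : fbags (lcrs D rest) = bags D ++ fbags rest.
Proof.
elim/btree_ind_nested: D rest => b Ds /= IH rest; congr (_ :: _ ++ _).
by elim: Ds IH => //= D Ds IHDs [-> /IHDs ->].
Qed.

(** * Assignments *)

(* An assignment to a list of variables is the sublist of the true ones. *)
Fixpoint subs (p : seq pvar) : seq (seq pvar) :=
  if p is x :: p' then subs p' ++ map (cons x) (subs p') else [:: [::]].

(** The result follows the order of [l], so two assignments with the same restriction to [l] yield
    the same list and hence the same variable name. *)
Definition keep (a l : seq pvar) := [seq x <- l | x \in a].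
Definition discard (a l : seq pvar) := [seq x <- l | x \notin a].

Lemma filter_subs (a : pred pvar) p : filter a p \in subs p.
Proof.
elim: p => //= x p IH; rewrite mem_cat; case: (a x); rewrite ?IH //.
by rewrite map_f ?orbT.
Qed.

Lemma size_subs p : size (subs p) = 2 ^ size p.
Proof. by elim: p => //= x p IH; rewrite size_cat size_map IH expnS; lia. Qed.

Lemma subseq_subs a p : a \in subs p -> subseq a p.
Proof.
elim: p a => [|x p IH] a /=; first by rewrite inE => /eqP->.
rewrite mem_cat => /orP[/IH sap|/mapP[a' /IH sap ->]].
  exact: subseq_trans sap (subseq_cons p x).
by rewrite /= eqxx.
Qed.

Lemma subs_uniq p : uniq p -> uniq (subs p).
Proof.
elim: p => //= x p IH /andP[xp /IH Up].
rewrite cat_uniq Up map_inj_uniq ?Up => [|? ? []//]; rewrite andbT /=.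
apply/hasPn=> _ /mapP[a _ ->]; apply: contra xp => /subseq_subs/mem_subseq.
by apply; rewrite mem_head.
Qed.

Lemma keep_filter (s : pred pvar) (p q : seq pvar) :
  {subset q <= p} -> keep (filter s p) q = filter s q.
Proof.
by move=> qp; apply: eq_in_filter => x /qp xp; rewrite mem_filter xp andbT.
Qed.

(** * Names *)

(* Preorder serialisation, a prefix code. *)
Fixpoint flat (d : data) (acc : seq bool) : seq bool :=
  if d is Cons a b then true :: flat a (flat b acc) else false :: acc.

Lemma flat_inj d d' acc acc' :
  flat d acc = flat d' acc' -> d = d' /\ acc = acc'.
Proof.
elim: d d' acc acc' => [|a IHa b IHb] [|a' b'] //= acc acc' [] //.
by move/IHa=> [-> /IHb[-> ->]].
Qed.

Lemma size_flat d acc : size (flat d acc) = dsize d + size acc.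
Proof. by elim: d acc => //= a IHa b IHb acc; rewrite IHa IHb addnA. Qed.

Lemma enc_bool_inj : injective enc_bool.
Proof. by case=> -[]. Qed.

Lemma enc_seq_inj (T : Type) (enc : T -> data) :
  injective enc -> injective (enc_seq enc).
Proof.
by move=> inj; elim=> [|x s IH] [|y t] //= [/inj-> /IH->].
Qed.

Lemma enc_pvar_inj : injective enc_pvar.
Proof. exact: enc_seq_inj enc_bool_inj. Qed.

(** * Tree decompositions *)

Definition linked (D : btree) (x : pvar) : Prop :=
  forall p q, in_bag_at D x p -> in_bag_at D x q ->
    exists s : seq position,
      [/\ path tree_adj p s, last p s = q & all (in_bag_at D x) s].

Definition occurs (D : btree) (x : pvar) : bool := x \in flatten (bags D).

Lemma in_bag_at_cons b Ds i Di x p :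
  onth Ds i = Some Di -> in_bag_at (BNode b Ds) x (i :: p) = in_bag_at Di x p.
Proof. by rewrite /in_bag_at /= => ->. Qed.

Lemma in_bag_atE b Ds x p :
  in_bag_at (BNode b Ds) x p ->
  (p = [::] /\ x \in b) \/
  exists i Di p', [/\ p = i :: p', onth Ds i = Some Di & in_bag_at Di x p'].
Proof.
case: p => [|i p]; first by left.
rewrite /in_bag_at /=; case eqDi: (onth Ds i) => [Di|] // xp.
by right; exists i, Di, p.
Qed.

Lemma occurs_nodeP b Ds x :
  reflect (x \in b \/ exists i Di, onth Ds i = Some Di /\ occurs Di x)
    (occurs (BNode b Ds) x).
Proof.
rewrite /occurs /= mem_cat; apply: (iffP orP) => -[xb|x_in]; try by left.
  right; elim: Ds x_in => //= D Ds IH; rewrite flatten_cat mem_cat.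
  case/orP=> [xD|/IH[i [Di [eqDi xi]]]]; first by exists 0, D.
  by exists i.+1, Di.
right; case: x_in => i [Di []]; elim: Ds i => [|D Ds IH] [|i] //=.
  by case=> <- xD; rewrite flatten_cat mem_cat /occurs in xD *; rewrite xD.
by move=> /IH{}IH /IH; rewrite flatten_cat mem_cat => ->; rewrite orbT.
Qed.

Lemma foldr_onth (Q : btree -> Prop) Ds i Di :
  foldr (fun D => and (Q D)) True Ds -> onth Ds i = Some Di -> Q Di.
Proof.
by elim: Ds i => [|D Ds IH] [|i] //= [QD QDs]; [case=> <- | apply: IH].
Qed.

Lemma occursP D x : occurs D x <-> exists p, in_bag_at D x p.
Proof.
elim/btree_ind_nested: D => b Ds IH; split.
  case/occurs_nodeP=> [xb|[i [Di [eqDi /(foldr_onth IH eqDi)[p xp]]]]].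
    by exists [::].
  by exists (i :: p); rewrite (in_bag_at_cons _ _ _ eqDi).
case=> p /in_bag_atE xp; apply/occurs_nodeP.
case: xp => [[_ xb]|[i [Di [p' [_ eqDi xp']]]]]; first by left.
by right; exists i, Di; split=> //; apply/(foldr_onth IH eqDi); exists p'.
Qed.

(** The edge above a node cuts the tree in two, and a variable found on both sides must be in the
    bags at both ends. Unlike the existence of paths, which may leave a subtree, this form passes
    directly to subtrees. *)
Definition separated (D : btree) (x : pvar) : Prop :=
  forall v i p q, in_bag_at D x (v ++ i :: p) -> in_bag_at D x q ->
    ~~ seq.prefix (rcons v i) q ->
    in_bag_at D x (rcons v i) /\ in_bag_at D x v.

(** A path from inside the subtree to the outside must leave it at some step, and the only edge out
    joins [rcons v i] to [v]. *)
Lemma linked_separated D x : linked D x -> separated D x.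
Proof.
move=> lk v i p q xp xq out_q; have [s [path_s last_s all_s]] := lk _ _ xp xq.
have in_p : seq.prefix (rcons v i) (v ++ i :: p).
  by rewrite -cat_rcons prefix_prefix.
elim: s (v ++ i :: p) xp in_p path_s last_s all_s => /= [|r s IH] u xu in_u.
  by move=> _ eq_uq; rewrite eq_uq (negbTE out_q) in in_u.
case/andP=> adj_ur path_s last_s /andP[xr all_s].
have [in_r|out_r] := boolP (seq.prefix (rcons v i) r); first exact: IH in_r _ _ _.
have {}in_u := in_u; case/prefixP: in_u => w eq_u.
case/orP: adj_ur => /eqP.
  move=> eq_r; case/negP: out_r; apply/prefixP.
  by exists (rcons w (last 0 r)); rewrite -rcons_cat -eq_u.
(* Now [r] is the parent of [u]; this leaves the subtree only when [u] is its root, so [r] is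
   [v]. *)
rewrite eq_u; case/lastP: w eq_u => [|w j] eq_u.
  by rewrite cats0 in eq_u * => /rcons_inj[eq_r _]; rewrite -eq_u eq_r.
rewrite -rcons_cat => /rcons_inj[eq_r _]; case/negP: out_r; rewrite -eq_r.
exact: prefix_prefix.
Qed.

Lemma separated_child b Ds i Di x :
  onth Ds i = Some Di -> separated (BNode b Ds) x -> separated Di x.
Proof.
move=> eqDi sep v j p q xp xq out_q; have := sep (i :: v) j p (i :: q).
rewrite /= !(in_bag_at_cons _ _ _ eqDi); apply=> //.
by rewrite eqxx.
Qed.

Lemma fvars_lcrs D rest x :
  (x \in fvars (lcrs D rest)) = occurs D x || (x \in fvars rest).
Proof. by rewrite /fvars fbags_lcrs flatten_cat mem_cat. Qed.

Lemma fvars_foldr_lcrs Ds x :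
  x \in fvars (foldr lcrs Leaf Ds) ->
  exists i Di, onth Ds i = Some Di /\ occurs Di x.
Proof.
elim: Ds => //= D Ds IH; rewrite fvars_lcrs => /orP[xD|/IH[i [Di [? ?]]]].
  by exists 0, D.
by exists i.+1, Di.
Qed.

Lemma connected_children D :
  (forall x, separated D x) ->
  connected_below (root_bag D) (foldr lcrs Leaf (children D)).
Proof.
elim/btree_ind_nested: D => b Ds IH sep /=.
have sep_child i Di : onth Ds i = Some Di -> forall x, separated Di x.
  by move=> eqDi x; apply: separated_child eqDi (sep x).
(* Apply separation to the edge between the root and child [i], with the root itself as outer
   position. *)
have to_root i Di x : onth Ds i = Some Di -> occurs Di x -> x \in b ->
    x \in root_bag Di.
  move=> eqDi /occursP[p xp] xb; have := sep x [::] i p [::].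
  rewrite !(in_bag_at_cons _ _ _ eqDi) => /(_ xp xb isT)[].
  by case: (Di).
(* Two distinct children are separated by the edge above the first of them, whose upper end is the
   root. *)
have to_parent i j Di Dj x : i != j ->
    onth Ds i = Some Di -> onth Ds j = Some Dj ->
    occurs Di x -> occurs Dj x -> x \in b.
  move=> neq eqDi eqDj /occursP[p xp] /occursP[q xq].
  have := sep x [::] i p (j :: q).
  rewrite /= !(in_bag_at_cons _ _ _ eqDi) (in_bag_at_cons _ _ _ eqDj).
  by rewrite (negbTE neq) => /(_ xp xq isT)[].
have {sep}IH i Di (eqDi : onth Ds i = Some Di) :=
  foldr_onth IH eqDi (sep_child i Di eqDi).
elim: Ds {sep_child} IH to_root to_parent => //= -[b1 Ds1] Ds IHDs IH to_root to_parent.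
have occurs1 x : x \in b1 ++ fvars (foldr lcrs Leaf Ds1) = occurs (BNode b1 Ds1) x.
  have := fvars_lcrs (BNode b1 Ds1) Leaf x.
  by rewrite fvars_Br /= /fvars /= !orbF.
split=> [|||x].
- exact: IH 0 _ erefl.
- apply: IHDs => [i Di|i Di x|i j Di Dj x neq]; first exact: (IH i.+1).
    exact: (to_root i.+1).
  exact: (to_parent i.+1 j.+1).
- by move=> x; rewrite occurs1 => x1; apply: (to_root 0 _ _ erefl).
- rewrite occurs1 => x1 /fvars_foldr_lcrs[i [Di [eqDi xi]]].
  exact: (to_parent 0 i.+1 _ Di).
Qed.

Lemma connected_lcrs D :
  (forall x, linked D x) -> connected_below [::] (lcrs D Leaf).
Proof.
move=> lk; have := connected_children (fun x => linked_separated (lk x)).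
by case: D {lk} => b Ds /= conn; split=> // x _; rewrite /fvars.
Qed.

(** * Connectivity of a tree assembled from its subtrees *)

Definition reachable (Q : pred position) (p q : position) : Prop :=
  Q p /\ exists s, [/\ path tree_adj p s, last p s = q & all Q s].

Lemma reachable_trans Q p q r :
  reachable Q p q -> reachable Q q r -> reachable Q p r.
Proof.
case=> Qp [s [ps ls Qs]] [_ [s' [ps' ls' Qs']]]; split=> //; exists (s ++ s').
by rewrite cat_path last_cat all_cat ls ps ps' Qs Qs'.
Qed.

Lemma reachable_sym Q p q : reachable Q p q -> reachable Q q p.
Proof.
case=> Qp [s [ps <- Qs]]; elim: s p Qp ps Qs => [|r s IH] p Qp /=.
  by split=> //; exists [::].
case/andP=> adj_pr ps /andP[Qr Qs]; apply: reachable_trans (IH r Qr ps Qs) _.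
by split=> //; exists [:: p]; rewrite /= Qp /tree_adj orbC andbT.
Qed.

Lemma is_child_cons i p q : is_child (i :: p) (i :: q) = is_child p q.
Proof. by rewrite /is_child /= eqseq_cons eqxx; case: q => //; case: p. Qed.

Lemma reachable_child b Ds i Di x p q :
  onth Ds i = Some Di -> reachable (in_bag_at Di x) p q ->
  reachable (in_bag_at (BNode b Ds) x) (i :: p) (i :: q).
Proof.
move=> eqDi [xp [s [ps <- xs]]]; split.
  by rewrite (in_bag_at_cons _ _ _ eqDi).
exists (map (cons i) s); split; last first.
- rewrite all_map; apply: sub_all xs => r xr /=.
  by rewrite (in_bag_at_cons _ _ _ eqDi).
- by rewrite last_map.
by rewrite path_map; apply: sub_path ps => r r'; rewrite /tree_adj /= !is_child_cons.
Qed.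

Lemma linkedP D x :
  (forall p q, in_bag_at D x p -> in_bag_at D x q -> reachable (in_bag_at D x) p q)
  <-> linked D x.
Proof.
by split=> H p q xp xq; [case: (H p q xp xq) | split=> //; apply: H].
Qed.

(** Either the root is a hub that every occurrence can reach, or all occurrences lie in a single
    subtree. *)
Lemma linked_node b Ds x :
  (forall i Di, onth Ds i = Some Di -> linked Di x) ->
  (x \in b -> forall i Di, onth Ds i = Some Di -> occurs Di x ->
     x \in root_bag Di) ->
  (x \notin b -> forall i j Di Dj, onth Ds i = Some Di -> onth Ds j = Some Dj ->
     occurs Di x -> occurs Dj x -> i = j) ->
  linked (BNode b Ds) x.
Proof.
move=> lk via_root one; apply/linkedP.
have [xb p q|xb p q] := boolP (x \in b).
  suff to_root r : in_bag_at (BNode b Ds) x r ->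
      reachable (in_bag_at (BNode b Ds) x) r [::].
    by move=> /to_root xp /to_root/reachable_sym; apply: reachable_trans.
  case/in_bag_atE=> [[-> _]|[i [Di [r' [-> eqDi xr']]]]].
    by split=> //; exists [::].
  have xi : in_bag_at Di x [::].
    have := via_root xb i Di eqDi; rewrite /in_bag_at /=; apply.
    by apply/occursP; exists r'.
  have /linkedP/(_ _ _ xr' xi)/(reachable_child b eqDi) := lk i Di eqDi.
  move/reachable_trans; apply; split; first by rewrite (in_bag_at_cons _ _ _ eqDi).
  exists [:: [::]].
  by split=> //=; rewrite ?/tree_adj /is_child /= ?eqxx // /in_bag_at /= xb.
case/in_bag_atE=> [[_ xb']|[i [Di [p' [-> eqDi xp']]]]]; first by rewrite xb' in xb.
case/in_bag_atE=> [[_ xb']|[j [Dj [q' [-> eqDj xq']]]]]; first by rewrite xb' in xb.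
have eq_ij : i = j.
  by apply: (one xb) eqDi eqDj _ _; apply/occursP; [exists p' | exists q'].
rewrite -eq_ij eqDi in eqDj *; case: eqDj xq' => <- xq'.
by apply: (reachable_child b eqDi); have /linkedP := lk i Di eqDi; apply.
Qed.

(** * Variables, terms and bags of the new formula *)

Section Reduction.

(* [pad] is longer than every variable of the input, which keeps the names of
   the new variables apart from the old ones. *)
Variables (pad : seq bool) (S2 : seq pvar) (psi : matrix).

Definition var_data (tag : bool) (pi : seq bool) (a : seq pvar) : data :=
  Cons (Cons (enc_bool tag) (enc_pvar pi)) (enc_seq enc_pvar a).

(* [vname false] is [s] and [vname true] is [r]. *)
Definition vname tag pi a : pvar := flat (var_data tag pi a) pad.

Lemma vname_inj tag pi a tag' pi' a' :
  vname tag pi a = vname tag' pi' a' -> [/\ tag = tag', pi = pi' & a = a'].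
Proof.
case/flat_inj=> [[/enc_bool_inj-> /enc_pvar_inj->]].
by move/(enc_seq_inj enc_pvar_inj)->.
Qed.

Lemma size_vname tag pi a : size pad < size (vname tag pi a).
Proof. by rewrite size_flat /=; lia. Qed.

(** A subproblem of the dynamic program: the path in the binary tree, deepest step first, so that
    ancestors have suffixes as paths; the bag of the parent of the trees in the list; the list
    itself. *)
Definition item := (seq bool * seq pvar * forest)%type.

Fixpoint items (pi : seq bool) (p : seq pvar) (F : forest) : seq item :=
  (pi, p, F) ::
  if F is Br b L1 L2 then
    items (false :: pi) b L1 ++ items (true :: pi) p L2
  else [::].

Definition names tag pi (l : seq (seq pvar)) := [seq vname tag pi a | a <- l].

Definition own_vars (it : item) : seq pvar :=
  let: (pi, p, F) := it in
  names false pi (subs p) ++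
  if F is Br b _ _ then names true pi (subs (keep b p)) else [::].

(** The [s] families of both successors are included because the implications of the item connect
    them with its own families. Removing [b] from [p] keeps the bag free of repetitions. *)
Definition out_bag (it : item) : seq pvar :=
  own_vars it ++
  (let: (pi, p, F) := it in
   if F is Br b _ _ then
     names false (false :: pi) (subs b) ++ names false (true :: pi) (subs p) ++
     discard S2 (b ++ discard b p)
   else [::]).

(** A clause with a variable outside [b] passes, so that every clause may be tested at every bag. *)
Definition good (b a : seq pvar) : bool :=
  all (has (fun l : literal => (l.1 \notin b) || ((l.1 \in a) == l.2))) psi.

(** A term is the conjunction of the premises and the negated conclusion. The literals of [b]
    outside [S2] are premises: they activate the implication only where [a] agrees with the outer
    assignment. For the empty list there are no premises, and [s] must be true. *)
Definition local_terms (it : item) : matrix :=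
  let: (pi, p, F) := it in
  if F is Br b _ _ then
    [seq [:: (vname false (true :: pi) a, true);
             (vname true pi (keep a (keep b p)), true);
             (vname false pi a, false)] | a <- subs p] ++
    [seq [:: (vname false (false :: pi) a, true),
             (vname true pi (keep a (keep b p)), false) &
             [seq (x, x \in a) | x <- discard S2 b]]
    | a <- subs b & good b a]
  else [seq [:: (vname false pi a, false)] | a <- subs p].

(* The contradictory terms make every variable of the bag a vertex of the
   primal graph. *)
Definition terms (it : item) : matrix :=
  [seq [:: (x, true); (x, false)] | x <- out_bag it] ++ local_terms it.

Definition new_vars (F : forest) : seq pvar :=
  flatten (map own_vars (items [::] [::] F)).

Definition new_matrix (F : forest) : matrix :=
  [:: (vname false [::] [::], true)] ::
  flatten (map terms (items [::] [::] F)).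

Fixpoint out_tree (pi : seq bool) (p : seq pvar) (F : forest) : btree :=
  BNode (out_bag (pi, p, F))
    (if F is Br b L1 L2 then
       [:: out_tree (false :: pi) b L1; out_tree (true :: pi) p L2]
     else [::]).

Lemma bags_out_tree pi p F : bags (out_tree pi p F) = map out_bag (items pi p F).
Proof.
elim: F pi p => //= b L1 IH1 L2 IH2 pi p.
by rewrite IH1 IH2 map_cat cats0.
Qed.

Lemma items_suffix pi p F it :
  it \in items pi p F -> exists w, it.1.1 = w ++ pi.
Proof.
elim: F pi p => [|b L1 IH1 L2 IH2] pi p /=.
  by rewrite inE => /eqP->; exists [::].
rewrite inE mem_cat => /or3P[/eqP->|/IH1[w ->]|/IH2[w ->]]; first by exists [::].
  by exists (rcons w false); rewrite cat_rcons.
by exists (rcons w true); rewrite cat_rcons.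
Qed.

Lemma suffix_incomparable (w w' pi : seq bool) x y :
  w ++ x :: pi = w' ++ y :: pi -> x = y.
Proof.
rewrite -!cat_rcons => eq_ww'.
have eq_sz : size (rcons w x) = size (rcons w' y).
  by move/(congr1 size): eq_ww'; rewrite !size_cat; lia.
by move/eqP: eq_ww'; rewrite eqseq_cat // eqseq_rcons => /andP[/andP[_ /eqP]].
Qed.

Lemma suffix_strict (w pi : seq bool) x : w ++ x :: pi <> pi.
Proof. by move/(congr1 size); rewrite size_cat /=; lia. Qed.

Lemma items_uniq pi p F : uniq [seq it.1.1 | it <- items pi p F].
Proof.
elim: F pi p => //= b L1 IH1 L2 IH2 pi p.
rewrite map_cat cat_uniq IH1 IH2 andbT mem_cat; apply/andP; split.
  apply/norP; split; apply/mapP => -[it /items_suffix[w eqw]];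
  by rewrite eqw => /esym/suffix_strict.
apply/hasPn=> _ /mapP[it /items_suffix[w ->] ->]; apply/mapP.
by case=> it' /items_suffix[w' ->] /suffix_incomparable.
Qed.

Lemma items_inj F it it' :
  it \in items [::] [::] F -> it' \in items [::] [::] F ->
  it.1.1 = it'.1.1 -> it = it'.
Proof.
have := items_uniq [::] [::] F; elim: (items _ _ F) => //= i s IH /andP[nis Us].
rewrite !inE => /predU1P[->|its] /predU1P[->|it's] // eq_pi.
- by case/negP: nis; apply/mapP; exists it'.
- by case/negP: nis; apply/mapP; exists it.
- exact: IH.
Qed.

Lemma items_head pi p F : (pi, p, F) \in items pi p F.
Proof. by case: F => *; rewrite /= mem_head. Qed.

Lemma items_sub pi p F pi0 p0 F0 :
  (pi, p, F) \in items pi0 p0 F0 -> {subset items pi p F <= items pi0 p0 F0}.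
Proof.
elim: F0 pi0 p0 => [|b L1 IH1 L2 IH2] pi0 p0 /=.
  by rewrite inE => /eqP[-> -> ->].
rewrite inE => /predU1P[[-> -> ->] //|].
rewrite mem_cat => /orP[/IH1|/IH2] sub it /sub;
by rewrite /= inE mem_cat => ->; rewrite ?orbT.
Qed.

Lemma items_children pi p b L1 L2 pi0 p0 F0 :
  (pi, p, Br b L1 L2) \in items pi0 p0 F0 ->
  (false :: pi, b, L1) \in items pi0 p0 F0 /\
  (true :: pi, p, L2) \in items pi0 p0 F0.
Proof.
by move/items_sub=> sub; split; apply: sub; rewrite /= inE mem_cat items_head ?orbT.
Qed.

Lemma items_bag pi p F it :
  it \in items pi p F ->
  (it.1.2 = p \/ it.1.2 \in fbags F) /\
  (if it.2 is Br b _ _ then b \in fbags F else true).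
Proof.
elim: F pi p => [|b L1 IH1 L2 IH2] pi p /=.
  by rewrite inE => /eqP->; split=> //; left.
rewrite inE mem_cat => /or3P[/eqP->|/IH1|/IH2] /=.
- by split; [left | rewrite mem_head].
- case=> H1 H2; split; last first.
    by case: (it.2) H2 => // ? _ _; rewrite inE mem_cat => ->; rewrite orbT.
  by right; rewrite inE mem_cat; case: H1 => ->; rewrite ?eqxx ?orbT.
- case=> H1 H2; split; last first.
    by case: (it.2) H2 => // ? _ _; rewrite inE mem_cat => ->; rewrite !orbT.
  by case: H1 => H1; [left | right; rewrite inE mem_cat H1 !orbT].
Qed.

(** * Correctness *)

Section Semantics.

Variable tau : assignment.

Definition consistent (b a : seq pvar) : bool :=
  all (fun x => (x \in S2) || ((x \in a) == tau x)) b.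

(** The recursion of the dynamic program. The choice of [a'] guesses only the [S2] part of the bag,
    since [consistent] fixes the rest to [tau]; the equation between the two restrictions is the
    join condition. *)
Fixpoint sat (F : forest) (p a : seq pvar) : bool :=
  if F is Br b L1 L2 then
    sat L2 p a &&
    has (fun a' => [&& good b a', consistent b a', sat L1 b a'
                     & keep a' (keep b p) == keep a (keep b p)]) (subs b)
  else true.

Definition agrees_on (s : assignment) (b : seq pvar) : bool :=
  good b (filter s b) && all (fun x => (x \in S2) || (s x == tau x)) b.

Lemma eq_good b a a' :
  {in b, forall x, (x \in a) = (x \in a')} -> good b a = good b a'.
Proof.
move=> eq_a; apply: eq_all => C; apply: eq_has => l.
by case: (boolP (l.1 \in b)) => //= lb; rewrite (eq_a _ lb).
Qed.

Lemma eq_agrees_on s s' b :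
  {in b, s =1 s'} -> agrees_on s b = agrees_on s' b.
Proof.
move=> eq_s; congr andb.
  by apply: eq_good => x xb; rewrite !mem_filter (eq_s x xb).
by apply: eq_in_all => x xb; rewrite (eq_s x xb).
Qed.

(* The connectivity condition lets partial solutions be glued. *)
Lemma sat_glue F p a :
  connected_below p F -> sat F p a ->
  exists2 s : assignment, {in p, forall x, s x = (x \in a)}
    & all (agrees_on s) (fbags F).
Proof.
elim: F p a => [|b L1 IH1 L2 IH2] p a /=; first by exists (mem a).
case=> c1 c2 pb_b pb_p /andP[sat2 /hasP[a' _ /and4P[gd cs sat1 /eqP eq_q]]].
have [s1 s1_b agr1] := IH1 b a' c1 sat1.
have [s2 s2_p agr2] := IH2 p a c2 sat2.
have eq_aa' x : x \in p -> x \in b -> (x \in a') = (x \in a).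
  move=> xp xb; have := congr1 (fun l => x \in l) eq_q.
  by rewrite /keep !mem_filter xp xb !andbT.
(* By connectivity the first tree meets [p] only inside [b] and meets the later trees only inside
   [p]; on these overlaps all pieces agree with [a]. *)
exists (fun x => if x \in b ++ fvars L1 then s1 x else
                 if x \in p then x \in a else s2 x).
  move=> x xp; rewrite xp; case: ifP => // x1.
  by have xb := pb_b x x1 xp; rewrite s1_b // eq_aa'.
apply/andP; split; last rewrite all_cat; last apply/andP; last split.
- rewrite (@eq_agrees_on _ s1) => [|x xb]; last by rewrite mem_cat xb.
  apply/andP; split.
    rewrite -(eq_good (a := a')) // => x xb.
    by rewrite mem_filter xb s1_b // andbT.
  by apply/allP=> x xb; have := allP cs x xb; rewrite s1_b.
- apply/allP=> c cL1; rewrite (@eq_agrees_on _ s1) ?(allP agr1) // => x xc.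
  by rewrite mem_cat (_ : x \in fvars L1) ?orbT //; apply/fvarsP; exists c.
- apply/allP=> c cL2; rewrite (@eq_agrees_on _ s2) ?(allP agr2) // => x xc.
  have xL2 : x \in fvars L2 by apply/fvarsP; exists c.
  case: ifP => [x1|_].
    have xp := pb_p x x1 xL2; have xb := pb_b x x1 xp.
    by rewrite s1_b // s2_p // eq_aa'.
  by case: ifP => // xp; rewrite s2_p.
Qed.

(* The intended values of the new variables: they falsify all terms, except for
   the one of the root if [F] is satisfiable. *)
Definition witness (F : forest) (y : pvar) : bool :=
  has (fun it : item =>
    has (fun a => (y == vname false it.1.1 a) && sat it.2 it.1.2 a)
      (subs it.1.2) ||
    (if it.2 is Br b L1 _ then
       has (fun a => [&& y == vname true it.1.1 (keep a (keep b it.1.2)),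
                         good b a, consistent b a & sat L1 b a]) (subs b)
     else false)) (items [::] [::] F).

Lemma witness_false F pi p G a :
  (pi, p, G) \in items [::] [::] F -> a \in subs p ->
  witness F (vname false pi a) = sat G p a.
Proof.
move=> it_in a_in; apply/idP/idP => [/hasP[[[pi' p'] G'] it'_in]|sat_a].
  case/orP=> /=.
    case/hasP=> a' _ /andP[/eqP/vname_inj[_ eq_pi <-]].
    by have [_ -> ->] := items_inj it_in it'_in eq_pi.
  by case: (G') => // b _ _ /hasP[].
apply/hasP; exists (pi, p, G) => //=; apply/orP; left.
by apply/hasP; exists a; rewrite // eqxx.
Qed.

Lemma witness_true F pi p b L1 L2 g :
  (pi, p, Br b L1 L2) \in items [::] [::] F ->
  witness F (vname true pi g) =
  has (fun a => [&& good b a, consistent b a, sat L1 b a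
                  & keep a (keep b p) == g]) (subs b).
Proof.
move=> it_in; apply/idP/idP => [/hasP[[[pi' p'] G'] it'_in]|/hasP[a a_in]].
  case/orP=> /=; first by case/hasP.
  case eqG': G' => [|b' L1' L2'] // /hasP[a' a'_in].
  case/and4P=> /eqP/vname_inj[_ eq_pi ->] gd cs st.
  move: a'_in gd cs st; have := items_inj it_in it'_in eq_pi.
  rewrite eqG' => -[_ -> -> -> _] a'_in gd cs st.
  by apply/hasP; exists a'; rewrite // gd cs st eqxx.
case/and4P=> gd cs st /eqP <-; apply/hasP; exists (pi, p, Br b L1 L2) => //=.
by apply/orP; right; apply/hasP; exists a; rewrite // eqxx gd cs st.
Qed.

End Semantics.

Lemma refuted_terms_force (s v : assignment) pi p F :
  cnf_true s psi ->
  {in p ++ fvars F, forall x, x \notin S2 -> v x = s x} ->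
  (forall it t, it \in items pi p F -> t \in local_terms it ->
     ~~ all (lit_true v) t) ->
  v (vname false pi (filter s p)).
Proof.
move=> sat_s; elim: F pi p => [|b L1 IH1 L2 IH2] pi p eq_vs refuted.
  have := refuted (pi, p, Leaf) [:: (vname false pi (filter s p), false)].
  rewrite mem_head /= => /(_ isT) /=; rewrite andbT /lit_true /= eqbF_neg negbK.
  by apply; apply/mapP; exists (filter s p); rewrite // filter_subs.
have refutedN t : t \in local_terms (pi, p, Br b L1 L2) -> ~~ all (lit_true v) t.
  by apply: refuted; rewrite mem_head.
have v1 : v (vname false (false :: pi) (filter s b)).
  apply: IH1 => [x|it t it_in]; last first.
    by apply: refuted; rewrite inE mem_cat it_in orbT.
  by move=> x_in; apply: eq_vs; rewrite mem_cat fvars_Br x_in orbT.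
have v2 : v (vname false (true :: pi) (filter s p)).
  apply: IH2 => [x|it t it_in]; last first.
    by apply: refuted; rewrite inE mem_cat it_in !orbT.
  rewrite mem_cat => x_in; apply: eq_vs; rewrite mem_cat fvars_Br.
  by case/orP: x_in => ->; rewrite ?orbT.
set q := keep b p in refutedN *.
have qp : {subset q <= p} by exact: mem_subseq (filter_subseq _ _).
have qb : {subset q <= b} by move=> x; rewrite mem_filter => /andP[].
(* In each clause the literal made true by [s] either lies outside [b] or has its value recorded in
   the restriction. *)
have gd : good b (filter s b).
  apply/allP=> C /(allP sat_s) /hasP[l lC /eqP l_true]; apply/hasP; exists l => //.
  by rewrite mem_filter l_true; case: (l.1 \in b); rewrite //= andbT eqxx.
have vr : v (vname true pi (filter s q)).
  have := refutedN [:: (vname false (false :: pi) (filter s b), true),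
             (vname true pi (keep (filter s b) q), false) &
             [seq (x, x \in filter s b) | x <- discard S2 b]].
  rewrite keep_filter //= {1}/lit_true /= v1 /= negb_and {1}/lit_true /=.
  rewrite eqbF_neg negbK => /(_ _)/orP[|//|].
    rewrite mem_cat; apply/orP; right; apply/mapP.
    by exists (filter s b); rewrite ?keep_filter // mem_filter gd filter_subs.
  (* The old literals hold because [v] and [s] agree outside [S2]. *)
  case/negP; apply/allP=> _ /mapP[x x_in ->]; rewrite /lit_true /=.
  move: x_in; rewrite /discard !mem_filter => /andP[xS2 xb]; rewrite xb andbT.
  by apply/eqP/eq_vs; rewrite // mem_cat fvars_Br mem_cat xb orbT.
have := refutedN [:: (vname false (true :: pi) (filter s p), true);
             (vname true pi (keep (filter s p) q), true);
             (vname false pi (filter s p), false)].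
rewrite keep_filter //= /lit_true /= v2 vr /= andbT eqbF_neg negbK; apply.
rewrite mem_cat; apply/orP; left; apply/mapP.
by exists (filter s p); rewrite ?keep_filter ?filter_subs.
Qed.

Lemma local_terms_witness tau F it t v :
  it \in items [::] [::] F -> t \in local_terms it ->
  {in fvars F, forall x, v x = tau x} ->
  (forall it', it' \in items [::] [::] F -> {in own_vars it', v =1 witness tau F}) ->
  ~~ all (lit_true v) t.
Proof.
case: it => -[pi p] G it_in t_in v_old v_new.
have v_s pi' p' G' a : (pi', p', G') \in items [::] [::] F -> a \in subs p' ->
    v (vname false pi' a) = sat tau G' p' a.
  move=> it'_in a_in; rewrite (v_new _ it'_in) ?(witness_false _ it'_in) //.
  by rewrite mem_cat map_f.
case: G it_in t_in => [|b L1 L2] it_in t_in.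
  case/mapP: t_in => a a_in ->; rewrite /= andbT /lit_true /=.
  by rewrite (v_s _ _ _ _ it_in).
have [it1_in it2_in] := items_children it_in.
have v_r a : v (vname true pi (keep a (keep b p))) =
    has (fun a' => [&& good b a', consistent tau b a', sat tau L1 b a'
                  & keep a' (keep b p) == keep a (keep b p)]) (subs b).
  rewrite (v_new _ it_in) ?(witness_true _ _ it_in) //.
  by rewrite mem_cat map_f ?orbT // filter_subs.
move: t_in; rewrite mem_cat => /orP[/mapP[a a_in ->]|/mapP[a]].
  rewrite /= /lit_true /= (v_s _ _ _ _ it_in) // (v_s _ _ _ _ it2_in) // v_r /=.
  by case: (sat tau L2 p a); case: has.
rewrite mem_filter => /andP[gd a_in] ->.
rewrite /= {1 2}/lit_true /= (v_s _ _ _ _ it1_in) // v_r.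
case st: (sat tau L1 b a) => //=; rewrite negb_and eqbF_neg negbK.
(* If [a] is consistent with [tau], it is itself a reason for [r] to be true, against the negative
   literal. If not, one of the old literals fails. *)
case cs: (consistent tau b a).
  by apply/orP; left; apply/hasP; exists a; rewrite // gd cs st eqxx.
apply/orP; right; apply: contraFN cs => /allP lits.
apply/allP=> x xb; case: (boolP (x \in S2)) => //= xS2.
have x_in : (x, x \in a) \in [seq (x, x \in a) | x <- discard S2 b].
  by apply/mapP; exists x; rewrite // mem_filter xS2 xb.
move: (lits _ x_in); rewrite /lit_true /= v_old 1?eq_sym //.
by apply/fvarsP; exists b; first by case: (items_bag it_in).
Qed.

Lemma old_notin_new_vars F x it :
  it \in items [::] [::] F -> size x <= size pad -> x \notin own_vars it.
Proof.
case: it => -[pi p] G _ szx; apply: contraL szx; rewrite -ltnNge mem_cat.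
case/orP; first by case/mapP=> a _ ->; apply: size_vname.
by case: G => // b _ _ /mapP[a _ ->]; apply: size_vname.
Qed.

(* The Helly property of subtrees.  Counting [p] as a bag makes the induction
   go through. *)
Lemma covering_bag p F (C : seq pvar) :
  connected_below p F ->
  {in C &, forall x y,
     exists2 b, b \in p :: fbags F & (x \in b) && (y \in b)} ->
  exists2 b, b \in p :: fbags F & {subset C <= b}.
Proof.
elim: F p => [|b L1 IH1 L2 IH2] p /=.
  move=> _ clique; exists p; first by rewrite mem_head.
  move=> x xC; have [b] := clique x x xC xC.
  by rewrite inE => /eqP-> /andP[].
case=> c1 c2 pb_b pb_p clique.
have cliqueE x y : x \in C -> y \in C ->
    [\/ (x \in p) && (y \in p),
        exists2 c, c \in b :: fbags L1 & (x \in c) && (y \in c)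
      | exists2 c, c \in fbags L2 & (x \in c) && (y \in c)].
  move=> xC yC; have [c + xy] := clique x y xC yC.
  rewrite !inE mem_cat => /or4P[/eqP eqc|cb|c1'|c2'].
  - by constructor 1; rewrite -eqc.
  - by constructor 2; exists c; rewrite // inE cb.
  - by constructor 2; exists c; rewrite // inE c1' orbT.
  - by constructor 3; exists c.
have in1 x c : c \in b :: fbags L1 -> x \in c -> x \in b ++ fvars L1.
  rewrite inE mem_cat => /orP[/eqP-> -> //|c1' xc].
  by apply/orP; right; apply/fvarsP; exists c.
have in2 x c : c \in fbags L2 -> x \in c -> x \in fvars L2.
  by move=> c2' xc; apply/fvarsP; exists c.
(* If [C] stays within the first tree, pairs that share [p] or a later bag share [b] as well, and
   the first induction hypothesis applies. Otherwise a variable [x] outside the first tree pushes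
   all of [C] towards [p] and the later trees. *)
have [sub1|/allPn[x xC x1]] := boolP (all [in b ++ fvars L1] C).
  have [y z yC zC|c] := IH1 b c1.
    have y1 := allP sub1 y yC; have z1 := allP sub1 z zC.
    have [/andP[yp zp]|//|[c c2' /andP[yc zc]]] := cliqueE y z yC zC.
      by exists b; rewrite ?mem_head // !pb_b.
    exists b; rewrite ?mem_head // !pb_b // pb_p //; exact: in2 c2' _.
  by rewrite inE => c_in subC; exists c => //;
  move: c_in; rewrite !inE mem_cat => /orP[]->; rewrite !orbT.
have [y z yC zC|c] := IH2 p c2; last first.
  rewrite inE => /orP[/eqP->|c_in] subC; first by exists p; rewrite ?mem_head.
  by exists c; rewrite // !inE mem_cat c_in !orbT.
(* The bag that [u] shares with [x] is not in the first tree: it is [p], or it is a later bag and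
   connectivity puts [u] into [p]. *)
have step u : u \in C -> u \in b ++ fvars L1 -> u \in p.
  move=> uC u1; have [/andP[]//|[c c1' /andP[xc _]]|[c c2' /andP[_ uc]]] :=
    cliqueE x u xC uC; first by rewrite (in1 x c) in x1.
  by apply: pb_p u1 _; exact: in2 c2' uc.
have [yzp|[c c1' /andP[yc zc]]|[c c2' yzc]] := cliqueE y z yC zC.
- by exists p; rewrite ?mem_head.
- by exists p; rewrite ?mem_head // !step // (in1 _ c).
- by exists c; rewrite // inE c2' orbT.
Qed.

(** * Semantics of quantifier blocks and elimination of the innermost one *)

Lemma eq_cnf_true s s' M : s =1 s' -> cnf_true s M = cnf_true s' M.
Proof.
by move=> eq_s; apply: eq_all => C; apply: eq_has => l; rewrite /lit_true eq_s.
Qed.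

Lemma eq_dnf_true s s' M : s =1 s' -> dnf_true s M = dnf_true s' M.
Proof.
by move=> eq_s; apply: eq_has => C; apply: eq_all => l; rewrite /lit_true eq_s.
Qed.

(** Successive updates reproduce a given assignment only pointwise, hence the extensionality
    hypothesis on [G]. *)
Lemma quantify_ExP X (G : assignment -> bool) tau :
  (forall s s', s =1 s' -> G s = G s') ->
  reflect (exists2 s : assignment, (forall y, y \notin X -> s y = tau y) & G s)
    (quantify Ex X G tau).
Proof.
move=> eqG; elim: X tau => [|x X IH] tau /=.
  apply: (iffP idP) => [Gt|[s eq_s]]; first by exists tau.
  by rewrite (eqG s tau) // => y; apply: eq_s.
apply: (iffP orP) => [[] /IH[s eq_s Gs]|[s eq_s Gs]].
- exists s => // y; rewrite inE negb_or => /andP[neq /eq_s ->].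
  by rewrite /update (negbTE neq).
- exists s => // y; rewrite inE negb_or => /andP[neq /eq_s ->].
  by rewrite /update (negbTE neq).
have ex : exists2 s', forall y, y \notin X -> s' y = update tau x (s x) y & G s'.
  exists s => // y yX; rewrite /update; case: eqVneq => [->//|neq].
  by apply: eq_s; rewrite inE negb_or neq.
by case: (s x) ex => /IH; [left | right].
Qed.

Lemma quantify_AllN X G tau :
  quantify All X G tau = ~~ quantify Ex X (fun s => ~~ G s) tau.
Proof.
by elim: X tau => /= [|x X IH] tau; rewrite ?negbK // negb_or !IH.
Qed.

Lemma quantify_cat q X Y G tau :
  quantify q (X ++ Y) G tau = quantify q X (quantify q Y G) tau.
Proof. by elim: X tau => //= x X IH tau; rewrite !IH. Qed.

Lemma eq_quantify q X G G' tau :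
  G =1 G' -> quantify q X G tau = quantify q X G' tau.
Proof. by move=> eqG; elim: X tau => //= x X IH tau; rewrite !IH. Qed.

Lemma eval_prefix_cat P Q G tau :
  eval_prefix (P ++ Q) G tau = eval_prefix P (eval_prefix Q G) tau.
Proof.
by elim: P tau => //= -[q X] P IH tau; apply: eq_quantify => s; apply: IH.
Qed.

Lemma eq_eval_prefix P G G' tau :
  G =1 G' -> eval_prefix P G tau = eval_prefix P G' tau.
Proof.
move=> eqG; elim: P tau => //= -[q X] P IH tau.
by apply: eq_quantify => s; apply: IH.
Qed.

Lemma mem_new_vars F y :
  reflect (exists2 it, it \in items [::] [::] F & y \in own_vars it)
    (y \in new_vars F).
Proof.
apply: (iffP flattenP) => [[_ /mapP[it it_in ->] y_in]|[it it_in y_in]].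
  by exists it.
by exists (own_vars it); rewrite ?map_f.
Qed.

Lemma dnf_new_matrix s F :
  dnf_true s (new_matrix F) =
  s (vname false [::] [::]) ||
  has (fun it => has (all (lit_true s)) (local_terms it)) (items [::] [::] F).
Proof.
rewrite /dnf_true /= andbT /lit_true /= eqb_id; congr orb.
elim: (items _ _ F) => //= it its IH; rewrite has_cat IH; congr orb.
rewrite /terms has_cat orb_idl // => /hasP[_ /mapP[x _ ->]] /=.
by rewrite /lit_true /=; case: (s x).
Qed.

(** Holding for every [tau], the equality passes through the outer quantifiers by congruence. With
    the universal block dualized, it says that a solution of the clauses exists exactly when no
    assignment falsifies the DNF. *)
Lemma innermost_block_eliminated F tau :
  connected_below [::] F ->
  {in fvars F, forall x, size x <= size pad} ->
  (forall C, C \in psi -> exists2 b, b \in fbags F & {subset map fst C <= b}) ->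
  quantify Ex S2 (cnf_true^~ psi) tau =
  quantify All (new_vars F) (dnf_true^~ (new_matrix F)) tau.
Proof.
move=> conn old covered; rewrite quantify_AllN.
have eqC s s' : s =1 s' -> cnf_true s psi = cnf_true s' psi.
  exact: eq_cnf_true.
have eqD s s' : s =1 s' ->
    ~~ dnf_true s (new_matrix F) = ~~ dnf_true s' (new_matrix F).
  by move=> /eq_dnf_true->.
have old_new x : x \in fvars F -> x \notin new_vars F.
  move/old=> szx; apply/negP=> /mem_new_vars[it it_in].
  by rewrite (negbTE (old_notin_new_vars it_in szx)).
apply/(quantify_ExP _ _ eqC)/(negPP (quantify_ExP _ _ eqD)).
  case=> s eq_s sat_s [v eq_v]; rewrite dnf_new_matrix negb_or => /andP[nroot].
  rewrite -all_predC => /allP refuted; case/negP: nroot.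
  apply: (refuted_terms_force (F := F) (p := [::]) sat_s) => [x xF xS2|it t it_in].
    by rewrite eq_s // eq_v // old_new.
  by move/refuted: it_in; rewrite /= -all_predC => /allP; apply.
move=> no_v; pose v y := if y \in new_vars F then witness tau F y else tau y.
have v_root : v (vname false [::] [::]) = sat tau F [::] [::].
  have it_in := items_head [::] [::] F.
  rewrite /v (_ : _ \in _) ?(witness_false _ it_in) //.
  by apply/mem_new_vars; exists ([::], [::], F); rewrite // mem_head.
have sat_F : sat tau F [::] [::].
  apply: contraPT no_v => nsat; apply; exists v => [y|].
    by rewrite /v => /negbTE->.
  rewrite dnf_new_matrix v_root negb_or nsat -all_predC.
  apply/allP=> it it_in; rewrite /= -all_predC; apply/allP=> t t_in.
  apply: (@local_terms_witness tau F it) => // [x xF|it' it'_in y y_in].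
    by rewrite /v (negbTE (old_new x xF)).
  by rewrite /v (_ : y \in new_vars F) //; apply/mem_new_vars; exists it'.
have [s _ agr] := sat_glue conn sat_F.
(* On every bag this is the glued assignment [s], which agrees with [tau] there outside [S2]. *)
exists (fun x => if x \in S2 then s x else tau x) => [x /negbTE-> //|].
apply/allP=> C C_in; have [b b_in subC] := covered C C_in.
have /andP[/allP/(_ C C_in)/hasP[l lC] l_good /allP cs] := allP agr b b_in.
have lb : l.1 \in b by apply: subC; rewrite map_f.
apply/hasP; exists l => //; rewrite /lit_true.
move: l_good; rewrite lb /= mem_filter lb andbT.
by case: ifP (cs _ lb) => //= _ /eqP->.
Qed.

(** * The tree decomposition of the output *)

Lemma namesP tag pi l y :
  reflect (exists2 a, a \in l & y = vname tag pi a) (y \in names tag pi l).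
Proof. exact: mapP. Qed.

Lemma mem_names tag pi l a :
  a \in l -> vname tag pi a \in names tag pi l.
Proof. exact: map_f. Qed.

Lemma mem_own_vars it y :
  y \in own_vars it -> exists tag a, y = vname tag it.1.1 a.
Proof.
case: it => -[pi p] G; rewrite mem_cat => /orP[/namesP[a _ ->]|] /=.
  by exists false, a.
by case: G => // b _ _ /namesP[a _ ->]; exists true, a.
Qed.

Lemma out_bag_old it x :
  size x <= size pad ->
  (x \in out_bag it) =
  (x \notin S2) && (if it.2 is Br b _ _ then (x \in b) || (x \in it.1.2) else false).
Proof.
move=> szx; have old tag pi l : (x \in names tag pi l) = false.
  by apply/namesP => -[a _ eq_x]; move: szx; rewrite eq_x leqNgt size_vname.
case: it => -[pi p] [|b L1 L2]; rewrite /out_bag /own_vars !mem_cat !old.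
  by rewrite /= !in_nil andbF.
by rewrite /= /discard mem_filter mem_cat mem_filter; case: (x \in b).
Qed.

Definition old_vars (it : item) : seq pvar :=
  if it.2 is Br b _ _ then b ++ it.1.2 else [::].

Lemma old_vars_sub pi p F it :
  it \in items pi p F -> {subset old_vars it <= p ++ fvars F}.
Proof.
move=> /items_bag; rewrite /old_vars; case: (it.2) => //= b _ _ [p_in b_in] x.
rewrite !mem_cat => /orP[xb|x_in]; apply/orP.
  by right; apply/fvarsP; exists b.
case: p_in => [<-|p_in]; first by left.
by right; apply/fvarsP; exists it.1.2.
Qed.

(** A new variable sits in the bag of its own item and possibly in that of the predecessor, so its
    occurrences span at most one edge of the output tree. *)
Lemma out_bag_new tag pi' a it :
  {in old_vars it, forall x, size x <= size pad} ->
  vname tag pi' a \in out_bag it ->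
  [\/ pi' = it.1.1,
      pi' = false :: it.1.1 /\ vname tag pi' a \in
        (if it.2 is Br b _ _ then names false pi' (subs b) else [::])
    | pi' = true :: it.1.1 /\ vname tag pi' a \in
        (if it.2 is Br b _ _ then names false pi' (subs it.1.2) else [::])].
Proof.
move=> old; rewrite mem_cat => /orP[/mem_own_vars[tag' [a' /vname_inj[_ -> _]]]|].
  by constructor 1.
case: it old => -[pi p] [|b L1 L2] //= old; rewrite !mem_cat => /or3P[y_in|y_in|].
- have /namesP[a' _ /vname_inj[_ eq_pi _]] := y_in.
  by constructor 2; rewrite eq_pi in y_in *.
- have /namesP[a' _ /vname_inj[_ eq_pi _]] := y_in.
  by constructor 3; rewrite eq_pi in y_in *.
rewrite mem_filter mem_cat mem_filter => /andP[_ y_in].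
have := old (vname tag pi' a); rewrite /old_vars /= leqNgt size_vname mem_cat.
by case/orP: y_in => [->|/andP[_ ->]]; rewrite ?orbT => /(_ isT).
Qed.

Lemma occurs_out_tree pi p F y :
  occurs (out_tree pi p F) y ->
  exists2 it, it \in items pi p F & y \in out_bag it.
Proof.
by rewrite /occurs bags_out_tree => /flattenP[_ /mapP[it it_in ->]]; exists it.
Qed.

Lemma root_out_tree pi p F : root_bag (out_tree pi p F) = out_bag (pi, p, F).
Proof. by case: F. Qed.

Lemma linked_node2 b D1 D2 x :
  linked D1 x -> linked D2 x ->
  (x \in b -> occurs D1 x -> x \in root_bag D1) ->
  (x \in b -> occurs D2 x -> x \in root_bag D2) ->
  (x \notin b -> occurs D1 x -> occurs D2 x -> False) ->
  linked (BNode b [:: D1; D2]) x.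
Proof.
move=> lk1 lk2 root1 root2 one; apply: linked_node.
- by move=> [|[|[]]] //= D [<-].
- by move=> xb [|[|[]]] //= D [<-]; [apply: root1 | apply: root2].
- move=> xb [|[|[]]] // [|[|[]]] //= D D' [<-] [<-] // o1 o2.
    by case: (one xb o1 o2).
  by case: (one xb o2 o1).
Qed.

(** The case distinction is needed because the bag of an empty list has no old variables, while that
    of a nonempty one repeats [p] outside [S2]. *)
Lemma occurs_out_tree_old pi p F x :
  size x <= size pad -> occurs (out_tree pi p F) x ->
  (x \notin S2) && (x \in (if F is Leaf then [::] else p) ++ fvars F).
Proof.
move=> szx /occurs_out_tree[[[pi' p'] G] it_in].
rewrite out_bag_old // => /andP[-> x_in] /=.
have := items_bag it_in; case: G x_in it_in => //= b L1 L2 x_in.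
case: F => [|b0 F1 F2]; first by rewrite inE => /eqP[].
move=> _ [p'_in b_in]; rewrite mem_cat.
case/orP: x_in => [xb|xp'].
  by apply/orP; right; apply/fvarsP; exists b.
case: p'_in => [<-|p'_in]; first by rewrite xp'.
by apply/orP; right; apply/fvarsP; exists p'.
Qed.

(** A chain of siblings carries the parent bag [p] along. A variable shared by two siblings belongs
    to [p], so stretching the star of children into a chain does not disconnect it. *)
Lemma linked_out_tree_old pi p F x :
  size x <= size pad -> connected_below p F -> linked (out_tree pi p F) x.
Proof.
move=> szx; elim: F pi p => [|b L1 IH1 L2 IH2] pi p.
  by move=> _; apply: linked_node => [[]|_ []|_ []].
case=> c1 c2 pb_b pb_p; apply: linked_node2; [exact: IH1 | exact: IH2 | ..];
  rewrite out_bag_old //=.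
- case/andP=> xS2 xbp /(occurs_out_tree_old szx)/andP[_].
  rewrite root_out_tree out_bag_old // xS2 mem_cat /=.
  case: (L1) pb_b pb_p => // b1 L11 L12 pb_b pb_p /orP[->|x1]; first exact: orbT.
  have x1' : x \in b ++ fvars (Br b1 L11 L12) by rewrite mem_cat x1 orbT.
  by case/orP: xbp => [->|/(pb_b _ x1')->]; rewrite orbT.
- case/andP=> xS2 xbp /(occurs_out_tree_old szx)/andP[_].
  rewrite root_out_tree out_bag_old // xS2 mem_cat /=.
  case: (L2) pb_p => // b2 L21 L22 pb_p /orP[->|x2]; first exact: orbT.
  case/orP: xbp => [xb|->]; last by rewrite orbT.
  by rewrite (pb_p x) ?orbT // mem_cat xb.
move=> x_out /(occurs_out_tree_old szx)/andP[xS2 x1].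
move: x_out; rewrite xS2 negb_or => /andP[xb xp].
case/(occurs_out_tree_old szx)/andP=> _ x2.
have {}x1 : x \in fvars L1.
  by move: x1; rewrite mem_cat => /orP[|//]; case: (L1) => //=; rewrite (negbTE xb).
have {}x2 : x \in fvars L2.
  by move: x2; rewrite mem_cat => /orP[|//]; case: (L2) => //=; rewrite (negbTE xp).
by case/negP: xp; apply: pb_p x2; rewrite mem_cat x1 orbT.
Qed.

(** Names below a child have paths that end in the path of the child. So no name lies below both
    children, and one that is also in the bag of the parent belongs to the family at the root of the
    child. *)
Lemma linked_out_tree_new tag pi' a pi p F :
  {in fvars F ++ p, forall x, size x <= size pad} ->
  linked (out_tree pi p F) (vname tag pi' a).
Proof.
set y := vname _ _ _; elim: F pi p => [|b L1 IH1 L2 IH2] pi p old.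
  by apply: linked_node => [[]|_ []|_ []].
have old1 : {in fvars L1 ++ b, forall x, size x <= size pad}.
  move=> x; rewrite mem_cat => x_in; apply: old.
  by rewrite mem_cat fvars_Br mem_cat; case/orP: x_in => ->; rewrite ?orbT.
have old2 : {in fvars L2 ++ p, forall x, size x <= size pad}.
  move=> x; rewrite mem_cat => x_in; apply: old.
  by rewrite mem_cat fvars_Br mem_cat; case/orP: x_in => ->; rewrite ?orbT.
have below pi0 p0 F0 : {in fvars F0 ++ p0, forall x, size x <= size pad} ->
    occurs (out_tree pi0 p0 F0) y -> exists w, pi' = w ++ pi0.
  move=> old0 /occurs_out_tree[it it_in y_in].
  have [w eq_pi] := items_suffix it_in.
  have [x|->|[-> _]|[-> _]] := out_bag_new _ y_in.
  - by move/(old_vars_sub it_in); rewrite mem_cat orbC -mem_cat => /old0.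
  - by exists w.
  - by exists (false :: w); rewrite eq_pi.
  - by exists (true :: w); rewrite eq_pi.
have old12 : {in old_vars (pi, p, Br b L1 L2), forall x, size x <= size pad}.
  move=> x; rewrite mem_cat => x_in; apply: old.
  by rewrite mem_cat fvars_Br mem_cat; case/orP: x_in => ->; rewrite ?orbT.
apply: linked_node2; [exact: IH1 | exact: IH2 | ..].
- move=> /(out_bag_new old12) /= y_in /(below _ _ _ old1)[w eq_pi].
  rewrite root_out_tree /out_bag /own_vars mem_cat; apply/orP; left.
  case: y_in => [eq_pi'|[eq_pi']|[eq_pi' _]].
  + by case: (@suffix_strict w pi false); rewrite -eq_pi.
  + by rewrite /y -eq_pi' mem_cat => ->.
  + have := @suffix_incomparable [::] w pi true false.
    by rewrite -eq_pi => /(_ (esym eq_pi')).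
- move=> /(out_bag_new old12) /= y_in /(below _ _ _ old2)[w eq_pi].
  rewrite root_out_tree /out_bag /own_vars mem_cat; apply/orP; left.
  case: y_in => [eq_pi'|[eq_pi' _]|[eq_pi']].
  + by case: (@suffix_strict w pi true); rewrite -eq_pi.
  + have := @suffix_incomparable [::] w pi false true.
    by rewrite -eq_pi => /(_ (esym eq_pi')).
  + by rewrite /y -eq_pi' mem_cat => ->.
move=> _ /(below _ _ _ old1)[w eq_w] /(below _ _ _ old2)[w' eq_w'].
by have := suffix_incomparable (etrans (esym eq_w) eq_w').
Qed.

Lemma out_bagP it y :
  y \in out_bag it ->
  (exists tag pi a, y = vname tag pi a) \/ (y \in old_vars it /\ y \notin S2).
Proof.
rewrite mem_cat => /orP[/mem_own_vars[tag [a ->]]|].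
  by left; exists tag, it.1.1, a.
case: it => -[pi p] [|b L1 L2] //=; rewrite /old_vars !mem_cat.
case/or3P=> [/namesP[a _ ->]|/namesP[a _ ->]|].
- by left; exists false, (false :: pi), a.
- by left; exists false, (true :: pi), a.
rewrite !mem_filter mem_cat mem_filter => /andP[yS2 y_in]; right; split=> //.
by case/orP: y_in => [->|/andP[_ ->]] //=; rewrite orbT.
Qed.

Lemma linked_out_tree F x :
  connected_below [::] F -> {in fvars F, forall y, size y <= size pad} ->
  linked (out_tree [::] [::] F) x.
Proof.
move=> conn old; have [/occurs_out_tree[it it_in x_in]|nx] :=
    boolP (occurs (out_tree [::] [::] F) x); last first.
  by move=> q r xq; case/negP: nx; apply/occursP; exists q.
have [[tag [pi [a ->]]]|[x_old _]] := out_bagP x_in.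
  by apply: linked_out_tree_new => y; rewrite cats0; apply: old.
by apply: linked_out_tree_old => //; apply: old; apply: old_vars_sub it_in _ x_old.
Qed.

Lemma old_vars_fvars F it :
  it \in items [::] [::] F -> {subset old_vars it <= fvars F}.
Proof. exact: old_vars_sub. Qed.

Lemma out_bag_bound F it y :
  it \in items [::] [::] F -> y \in out_bag it ->
  y \in new_vars F \/ (y \in fvars F /\ y \notin S2).
Proof.
move=> it_in; rewrite mem_cat => /orP[y_in|].
  by left; apply/mem_new_vars; exists it.
case: it it_in => -[pi p] [|b L1 L2] // it_in.
have [it1_in it2_in] := items_children it_in.
rewrite !mem_cat => /or3P[y_in|y_in|y_in].
- by left; apply/mem_new_vars; exists (false :: pi, b, L1); rewrite // mem_cat y_in.
- by left; apply/mem_new_vars; exists (true :: pi, p, L2); rewrite // mem_cat y_in.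
right; have /out_bagP[[tag [pi' [a eq_y]]]|[y_old yS2]] :
    y \in out_bag (pi, p, Br b L1 L2) by rewrite !mem_cat y_in !orbT.
  move: y_in; rewrite !mem_filter mem_cat mem_filter => /andP[-> y_in]; split=> //.
  apply: old_vars_fvars it_in _ _; rewrite mem_cat.
  by case/orP: y_in => [->|/andP[_ ->]]; rewrite ?orbT.
by split=> //; apply: old_vars_fvars it_in _ y_old.
Qed.

Lemma term_in_bag F t :
  t \in new_matrix F ->
  exists2 it, it \in items [::] [::] F & {subset clause_vars t <= out_bag it}.
Proof.
rewrite inE => /predU1P[->|/flattenP[_ /mapP[it it_in ->] t_in]].
  exists ([::], [::], F); first exact: items_head.
  by move=> y; rewrite inE => /eqP->; case: (F) => *; rewrite mem_head.
exists it => // y; move: t_in; rewrite mem_cat => /orP[/mapP[x x_in ->]|].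
  by rewrite !inE orbb => /eqP->.
case: it it_in => -[pi p] [|b L1 L2] it_in /=.
  by case/mapP=> a a_in ->; rewrite inE => /eqP->; rewrite !mem_cat mem_names.
rewrite mem_cat => /orP[/mapP[a a_in ->]|/mapP[a]].
  rewrite !inE !mem_cat => /or3P[]/eqP->; rewrite mem_names ?filter_subs ?orbT //.
rewrite mem_filter => /andP[_ a_in] ->; rewrite !inE !mem_cat.
case/or3P=> [/eqP->|/eqP->|]; rewrite ?mem_names ?filter_subs ?orbT //.
case/mapP=> _ /mapP[x x_in ->] /= ->; apply/orP; right.
move: x_in; rewrite /discard !mem_filter mem_cat => /andP[-> ->].
by rewrite !orbT.
Qed.

Lemma mem_new_matrix_vars F y :
  y \in matrix_vars (new_matrix F) <->
  exists2 it, it \in items [::] [::] F & y \in out_bag it.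
Proof.
split=> [/flattenP[_ /mapP[t /term_in_bag[it it_in sub] ->] /sub y_in]|].
  by exists it.
case=> it it_in y_in; apply/flattenP; exists (clause_vars [:: (y, true); (y, false)]).
  apply/map_f; rewrite inE; apply/orP; right; apply/flattenP.
  by exists (terms it); rewrite ?map_f // mem_cat map_f.
exact: mem_head.
Qed.

Lemma names_uniq tag pi l : uniq l -> uniq (names tag pi l).
Proof. by rewrite map_inj_uniq // => a a' /vname_inj[]. Qed.

Lemma names_disjoint tag pi l tag' pi' l' :
  (tag, pi) != (tag', pi') -> ~~ has [in names tag pi l] (names tag' pi' l').
Proof.
move=> neq; apply/hasPn=> _ /namesP[a _ ->]; apply/namesP=> -[a' _].
by case/vname_inj=> eq_tag eq_pi _; rewrite eq_tag eq_pi eqxx in neq.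
Qed.

Lemma own_vars_uniq it :
  uniq it.1.2 -> uniq (own_vars it).
Proof.
case: it => -[pi p] F /= Up; rewrite cat_uniq names_uniq ?subs_uniq //=.
case: F => //= b _ _; rewrite names_disjoint //= names_uniq // subs_uniq //.
exact: filter_uniq.
Qed.

Lemma out_bag_uniq it :
  {in old_vars it, forall x, size x <= size pad} ->
  uniq it.1.2 -> (if it.2 is Br b _ _ then uniq b else true) ->
  uniq (out_bag it).
Proof.
case: it => -[pi p] [|b L1 L2]; rewrite /out_bag /own_vars /= => old Up Ub.
  by rewrite !cats0 names_uniq ?subs_uniq.
have old_new tag pi' l : ~~ has [in names tag pi' l] (discard S2 (b ++ discard b p)).
  apply/hasPn=> x; rewrite mem_filter mem_cat mem_filter => /andP[_ x_in].
  apply/namesP=> -[a _ eq_x]; have := old x; rewrite eq_x leqNgt size_vname -eq_x.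
  by rewrite mem_cat; case/orP: x_in => [->|/andP[_ ->]]; rewrite ?orbT => /(_ isT).
have neq (c : bool) : (pi == c :: pi) = false.
  by apply/eqP=> /(congr1 size) /=; lia.
rewrite -catA !cat_uniq !has_cat !negb_or !old_new !names_uniq ?subs_uniq //;
  last exact: filter_uniq.
rewrite !names_disjoint ?xpair_eqE ?neq //= filter_uniq // cat_uniq Ub.
rewrite filter_uniq // andbT /=; apply/hasPn=> x.
by rewrite mem_filter => /andP[].
Qed.

Lemma new_vars_uniq F : {in fbags F, forall b, uniq b} -> uniq (new_vars F).
Proof.
move=> Ub; rewrite /new_vars.
have : {in items [::] [::] F, forall it, uniq (own_vars it)}.
  move=> it /items_bag[p_in _]; apply: own_vars_uniq.
  by case: p_in => [->|/Ub].
elim: (items _ _ F) (items_uniq [::] [::] F) => //= it its IH /andP[it_new Uits] Uown.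
rewrite cat_uniq (Uown it) ?mem_head //= IH ?andbT // => [|it' it'_in]; last first.
  by apply: Uown; rewrite inE it'_in orbT.
apply/hasPn=> y /flattenP[_ /mapP[it' it'_in ->] /mem_own_vars[tag [a eq_y]]].
apply/negP=> /mem_own_vars[tag' [a']]; rewrite eq_y => /vname_inj[_ eq_pi _].
by case/mapP: it_new; exists it'.
Qed.

(** Since [k + 1 <= 2 ^ k], the families and the old variables amount to at most [10 * 2 ^ k], and
    the constant 12 leaves slack. The successor accounts for the minus one in the width. *)
Lemma size_out_bag k it :
  size it.1.2 <= k.+1 -> (if it.2 is Br b _ _ then size b <= k.+1 else true) ->
  size (out_bag it) <= (12 * 2 ^ k).+1.
Proof.
have subs_le (p : seq pvar) : size p <= k.+1 -> 2 ^ size p <= 2 * 2 ^ k.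
  by rewrite -expnS leq_exp2l.
have k_lt : k < 2 ^ k by apply: ltn_expl.
case: it => -[pi p] [|b L1 L2]; rewrite /out_bag /own_vars /= => szp szb.
  by rewrite !size_cat !size_map size_subs /=; have := subs_le p szp; lia.
have szf a (l : seq pvar) n : size l <= n -> size (filter a l) <= n.
  by move=> szl; rewrite size_filter (leq_trans (count_size _ _)).
have szX : size (discard S2 (b ++ discard b p)) <= k.+1 + k.+1.
  by apply: (szf); rewrite size_cat leq_add //; apply: szf.
rewrite !size_cat !size_map !size_subs.
have := subs_le _ (szf [in b] _ _ szp); have := subs_le p szp; have := subs_le b szb.
move: szX k_lt; rewrite -/(keep b p); move: (size (discard _ _)) => n.
move: (2 ^ k) (2 ^ size b) (2 ^ size p) (2 ^ size (keep b p)) => K B P Q; lia.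
Qed.

Lemma out_tree_decomposition phi' F :
  body phi' = new_matrix F ->
  connected_below [::] F -> {in fvars F, forall x, size x <= size pad} ->
  {in fbags F, forall b, uniq b} ->
  tree_decomposition_of phi' (out_tree [::] [::] F).
Proof.
move=> eqM conn old Ub.
rewrite /tree_decomposition_of /primal_vertices /primal_edge eqM; split.
- move=> b; rewrite bags_out_tree => /mapP[it it_in ->].
  have [p_in b_in] := items_bag it_in.
  split; last by move=> y y_in; apply/mem_new_matrix_vars; exists it.
  apply: out_bag_uniq => [x /(old_vars_fvars it_in)/old //||].
    by case: p_in => [->|/Ub].
  by case: (it.2) b_in => // b0 _ _ /Ub.
- move=> x /mem_new_matrix_vars[it it_in x_in]; exists (out_bag it) => //.
  by rewrite bags_out_tree map_f.
- move=> x y _ _ /andP[_ /hasP[t /term_in_bag[it it_in sub] /andP[/sub xt /sub yt]]].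
  by exists (out_bag it); rewrite ?xt // bags_out_tree map_f.
- by move=> x; apply: linked_out_tree.
Qed.

Lemma width_out_tree k F :
  {in fbags F, forall b, size b <= k.+1} ->
  width (out_tree [::] [::] F) <= 12 * 2 ^ k.
Proof.
move=> szF; rewrite /width.
suff : \max_(b <- bags (out_tree [::] [::] F)) size b <= (12 * 2 ^ k).+1 by lia.
apply/bigmax_leqP_seq => b; rewrite bags_out_tree => /mapP[it it_in ->] _.
have [p_in b_in] := items_bag it_in; apply: size_out_bag.
  by case: p_in => [->|/szF].
by case: (it.2) b_in => // b0 _ _ /szF.
Qed.

End Reduction.

(** * The reduction *)

Section ReductionCorrect.

Variables (outer : seq block) (S1 S2 : seq pvar) (psi : matrix) (D : btree).
Variable pad : seq bool.

Let phi := Qbf (outer ++ [:: (All, S1); (Ex, S2)]) psi.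
Let F := lcrs D Leaf.
Let phi' := Qbf (outer ++ [:: (All, S1 ++ new_vars pad F)]) (new_matrix pad S2 psi F).

Hypothesis wf_phi : wf_qbf phi.
Hypothesis dec_phi : tree_decomposition_of phi D.
Hypothesis pad_long : {in bound_vars (Defs.prefix phi), forall x, size x <= size pad}.

Lemma fbags_input b :
  b \in fbags F -> uniq b /\ {subset b <= bound_vars (Defs.prefix phi)}.
Proof.
rewrite fbags_lcrs cats0; case: dec_phi => vs _ _ _ /vs[Ub sub]; split=> // x /sub.
by case: wf_phi => _; apply.
Qed.

Lemma fvars_input x : x \in fvars F -> x \in bound_vars (Defs.prefix phi).
Proof. by case/fvarsP=> b /fbags_input[_ sub] /sub. Qed.

Lemma fvars_short : {in fvars F, forall x, size x <= size pad}.
Proof. by move=> x /fvars_input/pad_long. Qed.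

Lemma connected_input : connected_below [::] F.
Proof. by apply: connected_lcrs => x p q; case: dec_phi => _ _ _; apply. Qed.

Lemma clause_covered C : C \in psi -> exists2 b, b \in fbags F & {subset map fst C <= b}.
Proof.
move=> C_in; have [b|b] := @covering_bag [::] F (map fst C) connected_input.
  move=> y; set x := b => xC yC.
  have occ z : z \in map fst C -> primal_vertices phi z.
    by move=> zC; apply/flattenP; exists (map fst C); rewrite ?map_f.
  case: dec_phi => _ cov1 cov2 _.
  (* The primal graph has no loops, so a single variable is covered as a vertex instead of as an
     edge. *)
  have [<-|neq] := eqVneq x y.
    have [c c_in xc] := cov1 x (occ x xC); exists c; last by rewrite xc.
    by rewrite inE fbags_lcrs cats0 c_in orbT.
  have [|c c_in xyc] := cov2 x y (occ x xC) (occ y yC).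
    by rewrite /primal_edge neq; apply/hasP; exists C; rewrite // xC yC.
  by exists c; rewrite // inE fbags_lcrs cats0 c_in orbT.
(* The fictitious empty bag above the root can cover only an empty clause, which any bag of [D]
   covers. *)
rewrite inE => /predU1P[-> sub|]; last by exists b.
exists (root_bag D); first by rewrite fbags_lcrs cats0; case: (D) => *; rewrite mem_head.
by move=> x /sub.
Qed.

Lemma bound_vars_cat P Q : bound_vars (P ++ Q) = bound_vars P ++ bound_vars Q.
Proof. by rewrite /bound_vars map_cat flatten_cat. Qed.

Lemma reduction_wf : wf_qbf phi'.
Proof.
case: wf_phi; rewrite /wf_qbf /= !bound_vars_cat /bound_vars /= !cats0 => Uphi _.
split.
  rewrite !catA cat_uniq new_vars_uniq ?andbT; last by move=> b /fbags_input[].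
  apply/andP; split; first by move: Uphi; rewrite !catA cat_uniq => /andP[].
  apply/hasPn=> y /mem_new_vars[it it_in y_in]; apply: contraTN y_in => y_old.
  apply: old_notin_new_vars it_in _; apply: pad_long.
  by rewrite /= bound_vars_cat /bound_vars /= cats0 catA mem_cat y_old.
move=> y /mem_new_matrix_vars[it it_in y_in]; rewrite !mem_cat.
have [->|[/fvars_input]] := out_bag_bound it_in y_in; first by rewrite !orbT.
rewrite /= bound_vars_cat /bound_vars /= cats0 !mem_cat => /or3P[->|->|->] //.
by rewrite orbT.
Qed.

(** The new innermost quantifier switches the matrix from CNF to DNF semantics. The new variables
    come last in the block of [S1], so elimination is applied under each fixed assignment of all
    earlier variables. *)
Lemma reduction_valid : valid phi <-> valid phi'.
Proof.
suff -> : valid phi = valid phi' by [].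
rewrite /valid /matrix_true /innermost /= !map_cat !last_cat /= !eval_prefix_cat.
apply: eq_eval_prefix => tau /=; rewrite quantify_cat.
apply: eq_quantify => s.
exact: innermost_block_eliminated connected_input fvars_short clause_covered.
Qed.

Lemma reduction_decomposition :
  tree_decomposition_of phi' (out_tree pad S2 [::] [::] F).
Proof.
apply: out_tree_decomposition connected_input fvars_short _ => //.
by move=> b /fbags_input[].
Qed.

Lemma reduction_width : width (out_tree pad S2 [::] [::] F) <= 12 * 2 ^ width D.
Proof.
apply: width_out_tree => b; rewrite fbags_lcrs cats0 => b_in.
apply: leq_trans (leqSpred _); exact: (@leq_bigmax_seq _ _ xpredT size).
Qed.

End ReductionCorrect.

(** * The program *)

Definition Fst (e : expr) := Case e Empty (Var 0).
Definition Snd (e : expr) := Case e Empty (Var 1).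
Definition TT := Pair Empty Empty.

(* [map_body f self] is the body of a function of index [self] that maps
   [(c, [:: x1; ..; xn])] to the concatenation of the lists [f (c, xi)]. *)
Definition append_index := 1.
Definition map_body (f self : nat) : expr :=
  Case (Snd (Var 0)) Empty
    (Call append_index
      (Pair (Call f (Pair (Fst (Var 2)) (Var 0)))
            (Call self (Pair (Fst (Var 2)) (Var 1))))).

Definition append_body : expr :=
  Case (Fst (Var 0)) (Snd (Var 0))
    (Pair (Var 0) (Call append_index (Pair (Var 1) (Snd (Var 2))))).

Definition eq_index := 2.
(** Each [Case] pushes two variables, so in the last call the indices 5 and 3 are the right
    components of the two arguments. *)
Definition eq_body : expr :=
  Case (Fst (Var 0))
    (Case (Snd (Var 0)) TT Empty)
    (Case (Snd (Var 2)) Empty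
      (Case (Call eq_index (Pair (Var 2) (Var 0))) Empty
        (Call eq_index (Pair (Var 5) (Var 3))))).

Definition flat_index := 3.
Definition flat_body : expr :=
  Case (Fst (Var 0)) (Pair Empty (Snd (Var 0)))
    (Pair TT (Call flat_index
      (Pair (Var 0) (Call flat_index (Pair (Var 1) (Snd (Var 2))))))).

(** True is encoded like a one-element list and false like the empty one, so a test mapped over a
    list by concatenation collects its successes. Membership then asks whether anything was
    collected. *)
Definition mem_body (occurrences : nat) : expr :=
  Case (Call occurrences (Var 0)) Empty TT.

Definition mem_index := 5.
Definition keep1_body : expr :=
  Case (Call mem_index (Pair (Snd (Var 0)) (Fst (Var 0)))) Empty
    (Pair (Snd (Var 2)) Empty).
Definition discard1_body : expr :=
  Case (Call mem_index (Pair (Snd (Var 0)) (Fst (Var 0))))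
    (Pair (Snd (Var 0)) Empty) Empty.

Definition keep_index := 7.
Definition discard_index := 9.

Definition singleton_body : expr := Pair (Var 0) Empty.
Definition cons_all_index := 11.

Definition subs_index := 12.
Definition subs_body : expr :=
  Case (Var 0) (Pair Empty Empty)
    (Let (Call subs_index (Var 1))
      (Call append_index
        (Pair (Var 0) (Call cons_all_index (Pair (Var 1) (Var 0)))))).

Definition name_index := 38.
Definition name_body : expr :=
  Call flat_index
    (Pair (Pair (Snd (Fst (Var 0))) (Snd (Var 0))) (Fst (Fst (Var 0)))).
Definition name1_body : expr := Pair (Call name_index (Var 0)) Empty.
Definition names_index := 14.

Definition items_index := 15.
Definition items_body : expr :=
  Pair (Var 0)
    (Case (Snd (Var 0)) Empty
      (Call append_index
        (Pair
          (Call items_index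
            (Pair (Pair (Pair Empty (Fst (Fst (Var 2)))) (Fst (Var 0)))
                  (Snd (Var 0))))
          (Call items_index
            (Pair (Pair (Pair TT (Fst (Fst (Var 2)))) (Snd (Fst (Var 2))))
                  (Var 1)))))).

(* Accessors for an argument [r = ((pad, (S2, psi)), ((pi, p), F))]. *)
Definition e_pad r := Fst (Fst r).
Definition e_S2 r := Fst (Snd (Fst r)).
Definition e_psi r := Snd (Snd (Fst r)).
Definition e_pi r := Fst (Fst (Snd r)).
Definition e_p r := Snd (Fst (Snd r)).
Definition e_F r := Snd (Snd r).
Definition e_b r := Fst (Fst (e_F r)).
Definition e_names r tag pi l :=
  Call names_index (Pair (Pair (e_pad r) (Pair tag pi)) l).
Definition e_name r tag pi a :=
  Call name_index (Pair (Pair (e_pad r) (Pair tag pi)) a).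
Definition e_append e1 e2 := Call append_index (Pair e1 e2).

Definition own_index := 16.
Definition own_body : expr :=
  e_append (e_names (Var 0) Empty (e_pi (Var 0)) (Call subs_index (e_p (Var 0))))
    (Case (e_F (Var 0)) Empty
      (e_names (Var 2) TT (e_pi (Var 2))
        (Call subs_index
          (Call keep_index (Pair (Fst (Var 0)) (e_p (Var 2))))))).

Definition bag_index := 17.
Definition bag_body : expr :=
  e_append (Call own_index (Var 0))
    (Case (e_F (Var 0)) Empty
      (e_append
        (e_names (Var 2) Empty (Pair Empty (e_pi (Var 2)))
          (Call subs_index (Fst (Var 0))))
        (e_append
          (e_names (Var 2) Empty (Pair TT (e_pi (Var 2)))
            (Call subs_index (e_p (Var 2))))
          (Call discard_index
            (Pair (e_S2 (Var 2))
              (e_append (Fst (Var 0))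
                (Call discard_index (Pair (Fst (Var 0)) (e_p (Var 2)))))))))).

Definition dummy_body : expr :=
  Pair (Pair (Pair (Snd (Var 0)) TT) (Pair (Pair (Snd (Var 0)) Empty) Empty))
    Empty.
Definition dummies_index := 19.

Definition lit_sat_body : expr :=
  Case (Call mem_index (Pair (Fst (Snd (Var 0))) (Fst (Fst (Var 0)))))
    TT
    (Call eq_index
      (Pair (Call mem_index (Pair (Fst (Snd (Var 2))) (Snd (Fst (Var 2)))))
            (Snd (Snd (Var 2))))).
Definition lits_sat_index := 21.
(** A universal check becomes an emptiness test: a clause is listed when none of its literals
    succeeds, and the assignment is good when no clause is listed. *)
Definition clause_unsat_body : expr :=
  Case (Call lits_sat_index (Var 0)) TT Empty.
Definition clauses_unsat_index := 23.

Definition lit_of_body : expr :=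
  Pair (Pair (Snd (Var 0))
             (Call mem_index (Pair (Snd (Var 0)) (Fst (Var 0))))) Empty.
Definition lits_of_index := 25.

(* The next three are called on [(r, a)]. *)
Definition leaf_term_body : expr :=
  let r := Fst (Var 0) in
  Pair (Pair (Pair (e_name r Empty (e_pi r) (Snd (Var 0))) Empty) Empty) Empty.
Definition leaf_terms_index := 27.

Definition e_proj r a :=
  e_name r TT (e_pi r)
    (Call keep_index (Pair a (Call keep_index (Pair (e_b r) (e_p r))))).

Definition join_term_body : expr :=
  let r := Fst (Var 0) in let a := Snd (Var 0) in
  Pair (Pair (Pair (e_name r Empty (Pair TT (e_pi r)) a) TT)
       (Pair (Pair (e_proj r a) TT)
       (Pair (Pair (e_name r Empty (e_pi r) a) Empty) Empty))) Empty.
Definition join_terms_index := 29.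

Definition project_term_body : expr :=
  Case (Call clauses_unsat_index
         (Pair (Pair (e_b (Fst (Var 0))) (Snd (Var 0))) (e_psi (Fst (Var 0)))))
    (let r := Fst (Var 0) in let a := Snd (Var 0) in
     Pair (Pair (Pair (e_name r Empty (Pair Empty (e_pi r)) a) TT)
          (Pair (Pair (e_proj r a) Empty)
          (Call lits_of_index
            (Pair a (Call discard_index (Pair (e_S2 r) (e_b r))))))) Empty)
    Empty.
Definition project_terms_index := 31.

Definition terms_index := 32.
Definition terms_body : expr :=
  e_append (Call dummies_index (Pair Empty (Call bag_index (Var 0))))
    (Case (e_F (Var 0))
      (Call leaf_terms_index (Pair (Var 0) (Call subs_index (e_p (Var 0)))))
      (e_append
        (Call join_terms_index (Pair (Var 2) (Call subs_index (e_p (Var 2)))))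
        (Call project_terms_index
          (Pair (Var 2) (Call subs_index (Fst (Var 0))))))).

Definition all_vars_index := 33.
Definition all_terms_index := 34.

Definition tree_index := 35.
Definition tree_body : expr :=
  Pair (Call bag_index (Var 0))
    (Case (e_F (Var 0)) Empty
      (Pair
        (Call tree_index
          (Pair (Fst (Var 2))
            (Pair (Pair (Pair Empty (e_pi (Var 2))) (Fst (Var 0)))
                  (Snd (Var 0)))))
        (Pair
          (Call tree_index
            (Pair (Fst (Var 2))
              (Pair (Pair (Pair TT (e_pi (Var 2))) (e_p (Var 2))) (Var 1))))
          Empty))).

Definition prefix_index := 36.
(** Looking ahead recognises the last two blocks; the first of them absorbs the new variables and
    the second is dropped. *)
Definition prefix_body : expr :=
  Case (Snd (Var 0)) Empty
    (Case (Var 1) Empty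
      (Case (Var 1)
        (Pair (Pair (Fst (Var 2))
                (e_append (Snd (Var 2)) (Fst (Var 4)))) Empty)
        (Pair (Var 4) (Call prefix_index (Pair (Fst (Var 6)) (Var 5)))))).

Definition last_index := 37.
Definition last_body : expr :=
  Case (Var 0) Empty
    (Case (Var 1) (Snd (Var 0)) (Call last_index (Var 3))).

(* After the three bindings the environment is [items; root; context; input]. *)
Definition main_body : expr :=
  Let (Pair (Call flat_index (Pair (Var 0) Empty))
            (Pair (Call last_index (Fst (Fst (Var 0)))) (Snd (Fst (Var 0)))))
  (Let (Pair (Pair Empty Empty) (Pair (Snd (Var 1)) Empty))
  (Let (Call items_index (Var 0))
  (Pair
    (Pair
      (Call prefix_index
        (Pair (Call all_vars_index (Pair (Var 2) (Var 0))) (Fst (Fst (Var 3)))))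
      (Pair
        (Pair (Pair (Call name_index
                      (Pair (Pair (Fst (Var 2)) (Pair Empty Empty)) Empty)) TT)
              Empty)
        (Call all_terms_index (Pair (Var 2) (Var 0)))))
    (Call tree_index (Pair (Var 2) (Var 1)))))).

(* The indices used above are positions in this list. *)
Definition reduction_program : program :=
  [:: main_body; append_body; eq_body; flat_body; map_body eq_index 4;
      mem_body 4; keep1_body; map_body 6 keep_index; discard1_body;
      map_body 8 discard_index; singleton_body; map_body 10 cons_all_index;
      subs_body; name1_body; map_body 13 names_index; items_body; own_body;
      bag_body; dummy_body; map_body 18 dummies_index; lit_sat_body;
      map_body 20 lits_sat_index; clause_unsat_body;
      map_body 22 clauses_unsat_index; lit_of_body; map_body 24 lits_of_index;
      leaf_term_body; map_body 26 leaf_terms_index; join_term_body;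
      map_body 28 join_terms_index; project_term_body;
      map_body 30 project_terms_index; terms_body;
      map_body own_index all_vars_index; map_body terms_index all_terms_index;
      tree_body; prefix_body; last_body; name_body].

(** * Running times *)

(** Time is only bounded from above, so that costs can be rounded up at every call. *)
Definition ev (env : seq data) (e : expr) (v : data) (T : nat) : Prop :=
  exists2 t, t <= T & eval reduction_program env e v t.

Definition computes (f : nat) (x y : data) (T : nat) : Prop :=
  ev [:: x] (nth Empty reduction_program f) y T.

Lemma ev_weaken env e v T T' : ev env e v T -> T <= T' -> ev env e v T'.
Proof. by case=> t le_t ev_t le_T; exists t => //; apply: leq_trans le_T. Qed.

Lemma computes_weaken f x y T T' : computes f x y T -> T <= T' -> computes f x y T'.
Proof. exact: ev_weaken. Qed.

Lemma computesI f body x y T T' :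
  nth Empty reduction_program f = body -> ev [:: x] body y T -> T <= T' ->
  computes f x y T'.
Proof. by move=> eq_body ev_T; apply: ev_weaken; rewrite eq_body. Qed.

Lemma ev_var env i v : nth Nil env i = v -> ev env (Var i) v 1.
Proof. by move<-; exists 1; last exact: eval_var. Qed.

Lemma ev_empty env : ev env Empty Nil 1.
Proof. by exists 1; last exact: eval_empty. Qed.

Lemma ev_pair env e1 e2 v1 v2 T1 T2 :
  ev env e1 v1 T1 -> ev env e2 v2 T2 ->
  ev env (Pair e1 e2) (Cons v1 v2) (T1 + T2).+1.
Proof.
by case=> t1 le1 ev1 [t2 le2 ev2]; exists (t1 + t2).+1; [lia | apply: eval_pair].
Qed.

Lemma ev_case_nil env e e1 e2 v T T1 :
  ev env e Nil T -> ev env e1 v T1 -> ev env (Case e e1 e2) v (T + T1).+1.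
Proof.
case=> t1 le1 ev1 [t2 le2 ev2]; exists (t1 + t2).+1; first lia.
exact: eval_case_nil.
Qed.

Lemma ev_case_cons env e e1 e2 a d v T T2 :
  ev env e (Cons a d) T -> ev [:: a, d & env] e2 v T2 ->
  ev env (Case e e1 e2) v (T + T2).+1.
Proof.
case=> t1 le1 ev1 [t2 le2 ev2]; exists (t1 + t2).+1; first lia.
exact: eval_case_cons ev1 ev2.
Qed.

Lemma ev_let env e1 e2 v1 v T1 T2 :
  ev env e1 v1 T1 -> ev (v1 :: env) e2 v T2 -> ev env (Let e1 e2) v (T1 + T2).+1.
Proof.
case=> t1 le1 ev1 [t2 le2 ev2]; exists (t1 + t2).+1; first lia.
exact: eval_let ev1 ev2.
Qed.

Lemma ev_call env f e v1 v T1 T2 :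
  ev env e v1 T1 -> computes f v1 v T2 -> ev env (Call f e) v (T1 + T2).+1.
Proof.
case=> t1 le1 ev1 [t2 le2 ev2]; exists (t1 + t2).+1; first lia.
exact: eval_call ev1 ev2.
Qed.

Lemma ev_fst env e a d T : ev env e (Cons a d) T -> ev env (Fst e) a (T + 1).+1.
Proof. by move=> ev_e; apply: ev_case_cons ev_e _; apply: ev_var. Qed.

Lemma ev_snd env e a d T : ev env e (Cons a d) T -> ev env (Snd e) d (T + 1).+1.
Proof. by move=> ev_e; apply: ev_case_cons ev_e _; apply: ev_var. Qed.

(** Symbolic execution that accumulates the cost in an existential variable. A call is closed by a
    hypothesis in the context, which is why proofs about a function first collect facts on its
    callees. *)
Ltac ev_run :=
  lazymatch goal with
  | |- ev _ (Var _) _ _ => apply ev_var; reflexivity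
  | |- ev _ Empty _ _ => apply ev_empty
  | |- ev _ (Pair _ _) _ _ => eapply ev_pair; [ev_run | ev_run]
  | |- ev _ TT _ _ => eapply ev_pair; [ev_run | ev_run]
  | |- ev _ (Fst _) _ _ => eapply ev_fst; ev_run
  | |- ev _ (Snd _) _ _ => eapply ev_snd; ev_run
  | |- ev _ (Let _ _) _ _ => eapply ev_let; [ev_run | ev_run]
  | |- ev _ (Call _ _) _ _ =>
      eapply ev_call;
        [ ev_run
        | match goal with H : computes _ _ _ _ |- _ => exact H end ]
  | |- ev _ (Case _ _ _) _ _ =>
      first [ eapply ev_case_nil; [ev_run | ev_run]
            | eapply ev_case_cons; [ev_run | ev_run] ]
  | |- ev ?env ?e ?v ?T =>
      let e' := eval red in e in change (ev env e' v T); cbv beta zeta; ev_run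
  end.

Ltac run_body := eapply computesI; [reflexivity | ev_run | ].

Lemma append_computes (T : Type) (enc : T -> data) l1 l2 :
  computes append_index (Cons (enc_seq enc l1) (enc_seq enc l2))
    (enc_seq enc (l1 ++ l2)) (20 * size l1 + 20).
Proof. by elim: l1 => [|x l1 IH]; run_body => /=; lia. Qed.

Lemma eq_computes x y :
  computes eq_index (Cons x y) (enc_bool (x == y)) (40 * dsize x).
Proof.
elim: x y => [|a IHa d IHd] [|a' d'].
- by rewrite eqxx; run_body.
- by rewrite (_ : _ == _ = false); [run_body | apply/eqP].
- by rewrite (_ : _ == _ = false); [run_body => /=; lia | apply/eqP].
have := IHa a'; have := IHd d'.
have -> : (Cons a d == Cons a' d') = (a == a') && (d == d').
  by apply/eqP/andP => [[-> ->]|[/eqP-> /eqP->]].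
by case: (a == a') => evd eva; run_body => /=; lia.
Qed.

Lemma flat_computes d acc :
  computes flat_index (Cons d (enc_pvar acc)) (enc_pvar (flat d acc))
    (40 * dsize d).
Proof.
elim: d acc => [|a IHa d IHd] acc; first by run_body.
have eva := IHa (flat d acc); have evd := IHd acc.
by run_body => /=; lia.
Qed.

(** The bound [m] on the pieces pays for concatenating them, as appending is linear in its first
    argument. *)
Lemma map_computes (A : eqType) (B : Type) (encA : A -> data) (encB : B -> data)
    f self ctx (g : A -> seq B) (l : seq A) T m :
  nth Empty reduction_program self = map_body f self ->
  {in l, forall x, computes f (Cons ctx (encA x)) (enc_seq encB (g x)) T} ->
  {in l, forall x, size (g x) <= m} ->
  computes self (Cons ctx (enc_seq encA l)) (enc_seq encB (flatten (map g l)))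
    ((size l).+1 * (T + 20 * m + 60)).
Proof.
move=> eq_body; elim: l => [|x l IH] ev_g size_g.
  by eapply computesI; [exact: eq_body | ev_run | ]; lia.
have evx := ev_g x (mem_head x l); have szx := size_g x (mem_head x l).
have evl : computes self (Cons ctx (enc_seq encA l))
    (enc_seq encB (flatten (map g l))) ((size l).+1 * (T + 20 * m + 60)).
  by apply: IH => y y_in; [apply: ev_g | apply: size_g]; rewrite inE y_in orbT.
have evapp := append_computes encB (g x) (flatten (map g l)).
by eapply computesI; [exact: eq_body | ev_run | ] => /=; nia.
Qed.

Lemma flatten_singletons (T U : Type) (h : T -> U) l :
  flatten [seq [:: h x] | x <- l] = map h l.
Proof. by elim: l => //= x l ->. Qed.

Lemma flatten_if (T U : Type) (a : pred T) (h : T -> U) l :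
  flatten [seq if a x then [:: h x] else [::] | x <- l] = [seq h x | x <- l & a x].
Proof. by elim: l => //= x l ->; case: (a x). Qed.

Lemma size_le_dsize (T : Type) (enc : T -> data) l : size l <= dsize (enc_seq enc l).
Proof. by elim: l => //= x l IH; lia. Qed.

Lemma dsize_mem (T : eqType) (enc : T -> data) l x :
  x \in l -> dsize (enc x) <= dsize (enc_seq enc l).
Proof. by elim: l => //= y l IH; rewrite inE => /predU1P[->|/IH]; lia. Qed.

Lemma dsize_subseq (T : eqType) (enc : T -> data) l l' :
  subseq l' l -> dsize (enc_seq enc l') <= dsize (enc_seq enc l).
Proof.
elim: l l' => [|y l IH] [|x l'] //=.
case: (eqVneq x y) => [->|_] /IH le_l; first by rewrite ltnS leq_add2l.
by apply: leq_trans le_l _; rewrite leqW // leq_addl.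
Qed.

Lemma dsize_cat (T : Type) (enc : T -> data) l l' :
  dsize (enc_seq enc (l ++ l')) < dsize (enc_seq enc l) + dsize (enc_seq enc l').
Proof. by elim: l => //= x l IH; lia. Qed.

Lemma dsize_subs p a :
  a \in subs p -> dsize (enc_seq enc_pvar a) <= dsize (enc_seq enc_pvar p).
Proof. by move/subseq_subs/dsize_subseq. Qed.

Lemma dsize_enc_pvar x : dsize (enc_pvar x) <= 4 * size x + 1.
Proof. by elim: x => //= -[] x IH /=; lia. Qed.

Lemma dsize_enc_seq_le (T : eqType) (enc : T -> data) l A :
  {in l, forall x, dsize (enc x) <= A} ->
  dsize (enc_seq enc l) <= size l * A.+1 + 1.
Proof.
elim: l => //= x l IH le_A; have := le_A x (mem_head x l).
have : dsize (enc_seq enc l) <= size l * A.+1 + 1.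
  by apply: IH => y yl; apply: le_A; rewrite inE yl orbT.
by rewrite mulSn; lia.
Qed.

Lemma subs_computes p :
  computes subs_index (enc_seq enc_pvar p) (enc_seq (enc_seq enc_pvar) (subs p))
    (300 * 2 ^ size p).
Proof.
elim: p => [|x p IH]; first by run_body.
have ev_cons : computes cons_all_index
    (Cons (enc_pvar x) (enc_seq (enc_seq enc_pvar) (subs p)))
    (enc_seq (enc_seq enc_pvar) (map (cons x) (subs p)))
    ((size (subs p)).+1 * (3 + 20 * 1 + 60)).
  rewrite -flatten_singletons; apply: (@map_computes _ _ _ _ 10) => // a _.
  by run_body.
have ev_app := append_computes (enc_seq enc_pvar) (subs p) (map (cons x) (subs p)).
run_body => /=; rewrite size_subs expnS; have : 0 < 2 ^ size p by rewrite expn_gt0.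
by lia.
Qed.

Definition enc_item (it : item) : data :=
  let: (pi, p, F) := it in
  Cons (Cons (enc_pvar pi) (enc_seq enc_pvar p)) (enc_forest F).

(** Quadratic, because every append copies the items of the first subtree. *)
Lemma items_computes pi p F :
  computes items_index (enc_item (pi, p, F)) (enc_seq enc_item (items pi p F))
    (100 * size (items pi p F) ^ 2).
Proof.
elim: F pi p => [|b L1 IH1 L2 IH2] pi p; first by run_body.
have ev1 := IH1 (false :: pi) b; have ev2 := IH2 (true :: pi) p.
have ev_app := append_computes enc_item (items (false :: pi) b L1)
  (items (true :: pi) p L2).
run_body; rewrite /= size_cat.
by move: (size _) (size _) => n1 n2; rewrite -!mulnn; nia.
Qed.

Lemma prefix_computes outer q1 q2 S1 S2 nv :
  computes prefix_index
    (Cons (enc_seq enc_pvar nv) (enc_seq enc_block (outer ++ [:: (q1, S1); (q2, S2)])))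
    (enc_seq enc_block (outer ++ [:: (q1, S1 ++ nv)]))
    (60 * size outer + 20 * size S1 + 100).
Proof.
elim: outer => [|B outer IH].
  by have ev_app := append_computes enc_pvar S1 nv; run_body => /=; lia.
by case: outer IH => [|B' [|B'' outer]] IH; run_body => /=; lia.
Qed.

Lemma last_computes outer q1 q2 S1 S2 :
  computes last_index (enc_seq enc_block (outer ++ [:: (q1, S1); (q2, S2)]))
    (enc_seq enc_pvar S2) (60 * size outer + 100).
Proof.
elim: outer => [|B outer IH]; last first.
  by case: outer IH => [|B' outer] IH; run_body => /=; lia.
have IH : computes last_index (enc_seq enc_block [:: (q2, S2)]) (enc_seq enc_pvar S2) 50.
  by run_body.
by run_body.
Qed.

(* A constant of its own, so that [lia] does not expand the powers. *)
Definition pw (M i : nat) := M ^ i.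

Lemma pw1 M : pw M 1 = M. Proof. exact: expn1. Qed.

(** * Costs of the functions in powers of the input size *)

Section Costs.

Variables (M k : nat) (pad : seq bool) (S2 : seq pvar) (psi : matrix).

Local Notation mu := (pw M).
Local Notation enc_pvars := (enc_seq enc_pvar).
Local Notation W := (2 ^ k).

(* One more factor [M] absorbs all constants of the next function. *)
Hypothesis M_large : 500 <= M.
Hypothesis S2_small : dsize (enc_pvars S2) <= M.
Hypothesis psi_small : dsize (enc_matrix psi) <= M.

Lemma W_gt0 : 0 < W. Proof. by rewrite expn_gt0. Qed.

Lemma mu_gt0 i : 0 < mu i.
Proof. by rewrite expn_gt0 (leq_trans _ M_large). Qed.

Lemma mu_step j i : j < i -> 500 * mu j <= mu i.
Proof.
move=> lt_ji; apply: (@leq_trans (M * mu j)); first by rewrite leq_mul2r M_large orbT.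
by rewrite -expnS leq_pexp2l // (leq_trans _ M_large).
Qed.

Lemma muW_step j i : j < i -> 500 * (W * mu j) <= W * mu i.
Proof. by move=> /mu_step; rewrite mulnCA leq_pmul2l // expn_gt0. Qed.

Lemma muW0 i : 500 * W <= W * mu i.+1.
Proof. by have := @muW_step 0 i.+1 isT; rewrite /pw expn0 muln1. Qed.

Lemma mu_muW i : mu i <= W * mu i.
Proof. by rewrite leq_pmull // expn_gt0. Qed.

(** Mapping loses a factor of at most 400, which one power of [M] absorbs. *)
Lemma map_cost n T m A B :
  n <= B -> T <= A -> m <= A -> 0 < A -> 0 < B ->
  n.+1 * (T + 20 * m + 60) <= M * (B * A).
Proof.
move=> nB TA mA A0 B0; apply: (@leq_trans ((2 * B) * (200 * A))).
  by apply: leq_mul; lia.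
by rewrite mulnACA leq_mul2r; apply/orP; right; lia.
Qed.

(** There are three versions of the cost of a map. At most one of the list length and the cost per
    element carries the factor [W], so no product reaches [W ^ 2]. *)
Lemma map_computes_poly (A : eqType) (B : Type) (encA : A -> data)
    (encB : B -> data) f self ctx (g : A -> seq B) (l : seq A) i :
  nth Empty reduction_program self = map_body f self ->
  {in l, forall x, computes f (Cons ctx (encA x)) (enc_seq encB (g x)) (mu i)} ->
  {in l, forall x, size (g x) <= mu i} -> size l <= M ->
  computes self (Cons ctx (enc_seq encA l)) (enc_seq encB (flatten (map g l)))
    (mu i.+2).
Proof.
move=> eq_body ev_g size_g szl.
apply: computes_weaken (map_computes eq_body ev_g size_g) _.
apply: leq_trans (map_cost szl (leqnn _) (leqnn _) _ _) _; rewrite ?mu_gt0 //.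
  by rewrite (leq_trans _ M_large).
by rewrite /pw !expnS.
Qed.

(** The allowance [20 * W] covers both the [2 * W] assignments of a bag and the [13 * W] variables
    of a new bag. *)
Lemma map_computes_exp (A : eqType) (B : Type) (encA : A -> data)
    (encB : B -> data) f self ctx (g : A -> seq B) (l : seq A) i :
  nth Empty reduction_program self = map_body f self ->
  {in l, forall x, computes f (Cons ctx (encA x)) (enc_seq encB (g x)) (mu i)} ->
  {in l, forall x, size (g x) <= mu i} -> size l <= 20 * W ->
  computes self (Cons ctx (enc_seq encA l)) (enc_seq encB (flatten (map g l)))
    (W * mu i.+2).
Proof.
move=> eq_body ev_g size_g szl.
apply: computes_weaken (map_computes eq_body ev_g size_g) _.
apply: leq_trans (map_cost szl (leqnn _) (leqnn _) _ _) _; rewrite ?mu_gt0 //.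
  by rewrite muln_gt0 expn_gt0.
have -> : W * mu i.+2 = M * (M * (W * mu i)) by rewrite /pw !expnS; lia.
by rewrite -mulnA leq_mul2l leq_mul2r (leq_trans _ M_large) ?orbT.
Qed.

Lemma map_computes_items (A : eqType) (B : Type) (encA : A -> data)
    (encB : B -> data) f self ctx (g : A -> seq B) (l : seq A) i :
  nth Empty reduction_program self = map_body f self ->
  {in l, forall x, computes f (Cons ctx (encA x)) (enc_seq encB (g x)) (W * mu i)} ->
  {in l, forall x, size (g x) <= W * mu i} -> size l <= M ->
  computes self (Cons ctx (enc_seq encA l)) (enc_seq encB (flatten (map g l)))
    (W * mu i.+2).
Proof.
move=> eq_body ev_g size_g szl.
apply: computes_weaken (map_computes eq_body ev_g size_g) _.
apply: leq_trans (map_cost szl (leqnn _) (leqnn _) _ _) _.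
- by rewrite muln_gt0 mu_gt0 expn_gt0.
- by rewrite (leq_trans _ M_large).
by rewrite /pw !expnS (mulnCA M W) (mulnCA M W).
Qed.

Lemma mem_computes x l :
  dsize (enc_pvar x) <= M -> dsize (enc_pvars l) <= M ->
  computes mem_index (Cons (enc_pvar x) (enc_pvars l)) (enc_bool (x \in l)) (mu 5).
Proof.
move=> szx szl; pose g y := if x == y then [:: Nil] else [::].
have occ : computes 4 (Cons (enc_pvar x) (enc_pvars l))
    (enc_seq id (flatten (map g l))) (mu 4).
  apply: (@map_computes_poly _ _ _ _ eq_index) => // [y _|y _|].
  - rewrite [enc_seq _ _](_ : _ = enc_bool (enc_pvar x == enc_pvar y)).
      apply: computes_weaken (eq_computes _ _) _.
      by have := @mu_step 1 2 isT; rewrite pw1; lia.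
    by rewrite (inj_eq enc_pvar_inj) /g; case: eqP.
  - by have := mu_gt0 2; rewrite /g; case: eqP.
  - exact: leq_trans (size_le_dsize _ _) szl.
rewrite flatten_if -[enc_bool _]/(enc_bool (x \in l)) in occ *.
have mu5 := @mu_step 4 5 isT; have mu4 := mu_gt0 4.
rewrite -has_pred1 (eq_has (a2 := eq_op x)) => [|y]; last exact: eq_sym.
rewrite has_filter; case: (filter _ l) occ => [|y l'] occ.
  by rewrite eqxx; run_body => /=; lia.
by rewrite -[_ != _]/true; run_body => /=; lia.
Qed.

Lemma keep_computes a l :
  dsize (enc_pvars a) <= M -> dsize (enc_pvars l) <= M ->
  computes keep_index (Cons (enc_pvars a) (enc_pvars l)) (enc_pvars (keep a l))
    (mu 8).
Proof.
move=> sza szl.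
have -> : keep a l = flatten [seq if x \in a then [:: x] else [::] | x <- l].
  by rewrite flatten_if map_id.
apply: (@map_computes_poly _ _ _ _ 6) => // [x xl|x xl|]; last 2 first.
- by have := mu_gt0 6; case: ifP.
- exact: leq_trans (size_le_dsize _ _) szl.
have := mem_computes (leq_trans (dsize_mem _ xl) szl) sza.
have := @mu_step 5 6 isT; have := mu_gt0 5.
by case: (x \in a) => mu5 mu6 ev_mem; run_body => /=; lia.
Qed.

Lemma discard_computes a l :
  dsize (enc_pvars a) <= M -> dsize (enc_pvars l) <= M ->
  computes discard_index (Cons (enc_pvars a) (enc_pvars l))
    (enc_pvars (discard a l)) (mu 8).
Proof.
move=> sza szl.
have -> : discard a l = flatten [seq if x \notin a then [:: x] else [::] | x <- l].
  by rewrite flatten_if map_id.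
apply: (@map_computes_poly _ _ _ _ 8) => // [x xl|x xl|]; last 2 first.
- by have := mu_gt0 6; case: ifP.
- exact: leq_trans (size_le_dsize _ _) szl.
have := mem_computes (leq_trans (dsize_mem _ xl) szl) sza.
have := @mu_step 5 6 isT; have := mu_gt0 5.
by case: (x \in a) => mu5 mu6 ev_mem; run_body => /=; lia.
Qed.

Definition enc_context : data :=
  Cons (enc_pvar pad) (Cons (enc_pvars S2) (enc_matrix psi)).

(** Encoding a word takes about four symbols per bit, whence the generous [5 * M] for paths; the
    callees accept [6 * M], leaving room for one more step. The two bags are bounded jointly because
    their concatenation becomes an argument. *)
Definition item_small (it : item) : Prop :=
  let: (pi, p, F) := it in
  [/\ dsize (enc_pvar pi) <= 5 * M, dsize (enc_pvars p) <= M, size p <= k.+1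
    & if F is Br b _ _ then
        size b <= k.+1 /\ dsize (enc_pvars b) + dsize (enc_pvars p) <= M
      else True].

Lemma name_computes tag pi a :
  dsize (enc_pvar pi) <= 6 * M -> dsize (enc_pvars a) <= M ->
  computes name_index
    (Cons (Cons (enc_pvar pad) (Cons (enc_bool tag) (enc_pvar pi))) (enc_pvars a))
    (enc_pvar (vname pad tag pi a)) (mu 2).
Proof.
move=> szpi sza; have ev_flat := flat_computes (var_data tag pi a) pad.
run_body; have := @mu_step 1 2 isT; rewrite pw1 /=.
by case: tag {ev_flat} => /=; lia.
Qed.

Lemma names_computes tag pi l :
  dsize (enc_pvar pi) <= 6 * M -> {in l, forall a, dsize (enc_pvars a) <= M} ->
  size l <= 20 * W ->
  computes names_index
    (Cons (Cons (enc_pvar pad) (Cons (enc_bool tag) (enc_pvar pi)))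
          (enc_seq enc_pvars l))
    (enc_pvars (names pad tag pi l)) (W * mu 5).
Proof.
move=> szpi sza szl; rewrite /names -flatten_singletons.
apply: (@map_computes_exp _ _ _ _ 13) => // [a al|a _]; last exact: mu_gt0.
have ev_name := name_computes tag szpi (sza a al).
by run_body; have := @mu_step 2 3 isT; have := mu_gt0 2; lia.
Qed.

Lemma size_subs_small p : size p <= k.+1 -> size (subs p) <= 2 * W.
Proof. by rewrite size_subs -expnS leq_exp2l. Qed.

Lemma size_subs20 p : size p <= k.+1 -> size (subs p) <= 20 * W.
Proof. by move/size_subs_small/leq_trans; apply; rewrite leq_mul2r orbT. Qed.

Lemma subs_computes_small p : size p <= k.+1 ->
  computes subs_index (enc_pvars p) (enc_seq enc_pvars (subs p)) (600 * W).
Proof.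
move=> szp; apply: computes_weaken (subs_computes p) _.
by have := size_subs_small szp; rewrite size_subs; lia.
Qed.

Lemma names_subs_computes tag pi p :
  dsize (enc_pvar pi) <= 6 * M -> dsize (enc_pvars p) <= M -> size p <= k.+1 ->
  computes names_index
    (Cons (Cons (enc_pvar pad) (Cons (enc_bool tag) (enc_pvar pi)))
          (enc_seq enc_pvars (subs p)))
    (enc_pvars (names pad tag pi (subs p))) (W * mu 5).
Proof.
move=> szpi sz_p szp; apply: names_computes => // [a /dsize_subs sza|].
  exact: leq_trans sza sz_p.
exact: size_subs20.
Qed.

Lemma size_names tag pi l : size (names pad tag pi l) = size l.
Proof. exact: size_map. Qed.

Lemma keep_small b p :
  dsize (enc_pvars p) <= M -> size p <= k.+1 ->
  dsize (enc_pvars (keep b p)) <= M /\ size (keep b p) <= k.+1.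
Proof.
move=> sz_p szp; split.
  exact: leq_trans (dsize_subseq _ (filter_subseq _ _)) sz_p.
exact: leq_trans (size_subseq (filter_subseq _ _)) szp.
Qed.

Lemma own_computes it : item_small it ->
  computes own_index (Cons enc_context (enc_item it))
    (enc_pvars (own_vars pad it)) (W * mu 9).
Proof.
case: it => -[pi p] F [sz_pi sz_p szp szF].
have sz_pi6 : dsize (enc_pvar pi) <= 6 * M by lia.
have ev_subs := subs_computes_small szp.
have ev_names := names_subs_computes false sz_pi6 sz_p szp.
have ev_app := append_computes enc_pvar (names pad false pi (subs p))
  (if F is Br b _ _ then names pad true pi (subs (keep b p)) else [::]).
have W0 := W_gt0.
have mu9 := @muW_step 5 9 isT; have mu8 := @muW_step 8 9 isT.
have mu8' := mu_muW 8; have mu5 := @mu_muW 5; have mu0 := muW0 4.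
have szs := size_subs_small szp.
case: F szF ev_app => [_|b L1 L2 [szb sz_bp]] ev_app.
  by run_body; rewrite size_names; lia.
have ev_keep : computes keep_index (Cons (enc_pvars b) (enc_pvars p))
  (enc_pvars (keep b p)) (mu 8) by apply: keep_computes => //; lia.
have [sz_q szq] := keep_small b sz_p szp.
have ev_subq := subs_computes_small szq.
have ev_namesq := names_subs_computes true sz_pi6 sz_q szq.
by run_body; rewrite size_names; lia.
Qed.

Lemma size_own it : item_small it -> size (own_vars pad it) <= 4 * W.
Proof.
case: it => -[pi p] F [_ sz_p szp szF]; have := size_subs_small szp; have := W_gt0.
rewrite size_cat size_names; case: F szF => [|b L1 L2] _ /=; first by lia.
have [_ szq] := keep_small b sz_p szp; have := size_subs_small szq.
by rewrite size_names; lia.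
Qed.

Lemma small_le_M (n : nat) : n <= 500 -> n <= M.
Proof. by move=> le_n; apply: leq_trans le_n M_large. Qed.

Lemma child_path_small (c : bool) pi :
  dsize (enc_pvar pi) <= 5 * M -> dsize (enc_pvar (c :: pi)) <= 6 * M.
Proof. by have := small_le_M (isT : 4 <= 500); case: c => /=; lia. Qed.

Lemma bag_computes it : item_small it ->
  computes bag_index (Cons enc_context (enc_item it))
    (enc_pvars (out_bag pad S2 it)) (W * mu 10).
Proof.
move=> it_small; have ev_own := own_computes it_small.
have sz_own := size_own it_small; have W0 := W_gt0.
have mu9 := muW_step (isT : 9 < 10); have mu0 := muW0 8.
have mu5 := muW_step (isT : 5 < 9).
have mu8 := muW_step (isT : 8 < 9); have mu8' := mu_muW 8.
have mu1 := mu_step (isT : 1 < 8); rewrite pw1 in mu1.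
case: it it_small ev_own sz_own => -[pi p] F [sz_pi sz_p szp szF] ev_own sz_own.
case: F szF ev_own sz_own => [_|b L1 L2 [szb sz_bp]] ev_own sz_own.
  have ev_app := append_computes enc_pvar (own_vars pad (pi, p, Leaf)) [::].
  by run_body; lia.
have sz_b : dsize (enc_pvars b) <= M by lia.
have ev_subb := subs_computes_small szb; have ev_subp := subs_computes_small szp.
have ev_nb := names_subs_computes false
  (child_path_small false sz_pi) sz_b szb.
have ev_np := names_subs_computes false
  (child_path_small true sz_pi) sz_p szp.
have ev_dp := discard_computes sz_b sz_p.
have sz_b_le := size_le_dsize enc_pvar b.
have ev_app1 := append_computes enc_pvar b (discard b p).
have ev_dS : computes discard_index
    (Cons (enc_pvars S2) (enc_pvars (b ++ discard b p)))
    (enc_pvars (discard S2 (b ++ discard b p))) (mu 8).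
  apply: discard_computes => //.
  have := dsize_cat enc_pvar b (discard b p).
  have : dsize (enc_pvars (discard b p)) <= dsize (enc_pvars p).
    exact: dsize_subseq (filter_subseq _ _).
  by lia.
have ev_app2 := append_computes enc_pvar (names pad false (true :: pi) (subs p))
  (discard S2 (b ++ discard b p)).
have ev_app3 := append_computes enc_pvar (names pad false (false :: pi) (subs b))
  (names pad false (true :: pi) (subs p) ++ discard S2 (b ++ discard b p)).
have ev_app4 := append_computes enc_pvar (own_vars pad (pi, p, Br b L1 L2))
  (names pad false (false :: pi) (subs b) ++
   names pad false (true :: pi) (subs p) ++ discard S2 (b ++ discard b p)).
have szsb := size_subs_small szb; have szsp := size_subs_small szp.
run_body; rewrite !size_names.
by move: (size (own_vars _ _)) sz_own => n sz_own; lia.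
Qed.

Lemma size_out_bag_small it :
  item_small it -> size (out_bag pad S2 it) <= 13 * W.
Proof.
case: it => -[pi p] F [_ _ szp szF]; have W0 := W_gt0.
suff : size (out_bag pad S2 (pi, p, F)) <= (12 * W).+1 by lia.
by apply: size_out_bag => //=; case: F szF => // b L1 L2 [].
Qed.

Lemma dummies_computes l : size l <= 20 * W ->
  computes dummies_index (Cons Nil (enc_pvars l))
    (enc_matrix [seq [:: (x, true); (x, false)] | x <- l]) (W * mu 3).
Proof.
move=> szl; rewrite /enc_matrix -flatten_singletons.
apply: (map_computes_exp (f := 18)) => // [x _|x _].
  by run_body; rewrite pw1; apply: small_le_M.
exact: mu_gt0.
Qed.

Lemma lit_sat_computes b a (l : literal) :
  dsize (enc_pvars b) <= M -> dsize (enc_pvars a) <= M ->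
  dsize (enc_pvar l.1) <= M ->
  computes 20 (Cons (Cons (enc_pvars b) (enc_pvars a)) (enc_literal l))
    (enc_bool ((l.1 \notin b) || ((l.1 \in a) == l.2))) (mu 6).
Proof.
case: l => x c sz_b sz_a /= sz_x.
have ev_b := mem_computes sz_x sz_b; have ev_a := mem_computes sz_x sz_a.
have ev_eq := eq_computes (enc_bool (x \in a)) (enc_bool c).
rewrite (inj_eq enc_bool_inj) in ev_eq.
have sz_bool : dsize (enc_bool (x \in a)) <= 3 by case: (x \in a).
have mu6 := mu_step (isT : 5 < 6).
have mu1 := mu_step (isT : 1 < 5); have M1 := M_large.
rewrite pw1 in mu1.
case: (x \in b) ev_b => /= ev_b.
  by run_body; lia.
by run_body; lia.
Qed.

(** The caller branches only on emptiness, so the list of falsified clauses itself is left open. *)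
Lemma good_computes b a :
  dsize (enc_pvars b) <= M -> dsize (enc_pvars a) <= M ->
  exists2 v, computes clauses_unsat_index
      (Cons (Cons (enc_pvars b) (enc_pvars a)) (enc_matrix psi)) v (mu 11)
    & if good psi b a then v = Nil else exists d d', v = Cons d d'.
Proof.
move=> sz_b sz_a; pose lsat (l : literal) := (l.1 \notin b) || ((l.1 \in a) == l.2).
pose sat1 l := if lsat l then [:: Nil] else [::].
have ev_lits C : C \in psi -> computes lits_sat_index
    (Cons (Cons (enc_pvars b) (enc_pvars a)) (enc_seq enc_literal C))
    (enc_seq id (flatten (map sat1 C))) (mu 8).
  move=> C_in; have sz_C := leq_trans (dsize_mem (enc_seq enc_literal) C_in) psi_small.
  apply: (map_computes_poly (f := 20)) => // [l l_in|l _|].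
  - have -> : enc_seq id (sat1 l) = enc_bool (lsat l) by rewrite /sat1; case: ifP.
    apply: lit_sat_computes => //; apply: leq_trans sz_C.
    by apply: leq_trans (dsize_mem enc_literal l_in); rewrite /=; lia.
  - by have := mu_gt0 6; rewrite /sat1; case: ifP.
  - exact: leq_trans (size_le_dsize _ _) sz_C.
pose unsat C := if ~~ has lsat C then [:: Nil] else [::].
have ev_clauses : computes clauses_unsat_index
    (Cons (Cons (enc_pvars b) (enc_pvars a)) (enc_matrix psi))
    (enc_seq id (flatten (map unsat psi))) (mu 11).
  apply: (map_computes_poly (f := 22)) => // [C C_in|C _|].
  - have := ev_lits C C_in; rewrite flatten_if /unsat has_filter.
    have mu8 := mu_step (isT : 8 < 9); have mu8' := mu_gt0 8.
    by case: (filter _ C) => [|l ls] ev_C; rewrite ?eqxx; run_body; lia.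
  - by have := mu_gt0 9; rewrite /unsat; case: ifP.
  - exact: leq_trans (size_le_dsize _ _) psi_small.
exists (enc_seq id (flatten (map unsat psi))) => //.
rewrite flatten_if /good -[all _ _]negbK -has_predC has_filter negbK.
rewrite (eq_filter (a2 := fun C => ~~ has lsat C)) //.
by case: (filter _ psi) => [|C Cs]; rewrite ?eqxx //=; do 2!eexists.
Qed.

Lemma lits_of_computes a l :
  dsize (enc_pvars a) <= M -> dsize (enc_pvars l) <= M ->
  computes lits_of_index (Cons (enc_pvars a) (enc_pvars l))
    (enc_seq enc_literal [seq (x, x \in a) | x <- l]) (mu 8).
Proof.
move=> sz_a sz_l; rewrite -flatten_singletons.
apply: (map_computes_poly (f := 24)) => // [x xl|x _|].
- have ev_mem := mem_computes (leq_trans (dsize_mem enc_pvar xl) sz_l) sz_a.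
  by run_body; have := mu_step (isT : 5 < 6); have := mu_gt0 5; lia.
- exact: mu_gt0.
- exact: leq_trans (size_le_dsize _ _) sz_l.
Qed.

Lemma path_small6 pi : dsize (enc_pvar pi) <= 5 * M -> dsize (enc_pvar pi) <= 6 * M.
Proof. by lia. Qed.

Lemma leaf_terms_computes pi p : item_small (pi, p, Leaf) ->
  computes leaf_terms_index
    (Cons (Cons enc_context (enc_item (pi, p, Leaf))) (enc_seq enc_pvars (subs p)))
    (enc_matrix [seq [:: (vname pad false pi a, false)] | a <- subs p])
    (W * mu 5).
Proof.
case=> sz_pi sz_p szp _; rewrite /enc_matrix -flatten_singletons.
apply: (map_computes_exp (f := 26)) => // [a /dsize_subs sz_a|a _|].
- have ev_name := name_computes false (path_small6 sz_pi)
    (leq_trans sz_a sz_p).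
  by run_body; have := mu_step (isT : 2 < 3); have := mu_gt0 2; lia.
- exact: mu_gt0.
- exact: size_subs20.
Qed.

Lemma join_terms_computes pi p b L1 L2 : item_small (pi, p, Br b L1 L2) ->
  computes join_terms_index
    (Cons (Cons enc_context (enc_item (pi, p, Br b L1 L2))) (enc_seq enc_pvars (subs p)))
    (enc_matrix [seq [:: (vname pad false (true :: pi) a, true);
             (vname pad true pi (keep a (keep b p)), true);
             (vname pad false pi a, false)] | a <- subs p])
    (W * mu 11).
Proof.
case=> sz_pi sz_p szp [szb sz_bp]; rewrite /enc_matrix -flatten_singletons.
have sz_b : dsize (enc_pvars b) <= M by lia.
apply: (map_computes_exp (f := 28)) => // [a /dsize_subs sz_a|a _|].
- have {}sz_a := leq_trans sz_a sz_p; have sz_pi6 := path_small6 sz_pi.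
  have [sz_q szq] := keep_small b sz_p szp.
  have [sz_r szr] := keep_small a sz_q szq.
  have ev_name1 := name_computes false (child_path_small true sz_pi) sz_a.
  have ev_name2 := name_computes false sz_pi6 sz_a.
  have ev_name3 := name_computes true sz_pi6 sz_r.
  have ev_q := keep_computes sz_b sz_p.
  have ev_r := keep_computes sz_a sz_q.
  by run_body; have := mu_step (isT : 8 < 9);
    have := mu_step (isT : 2 < 8); have := mu_gt0 2; lia.
- exact: mu_gt0.
- exact: size_subs20.
Qed.

Lemma project_terms_computes pi p b L1 L2 : item_small (pi, p, Br b L1 L2) ->
  computes project_terms_index
    (Cons (Cons enc_context (enc_item (pi, p, Br b L1 L2))) (enc_seq enc_pvars (subs b)))
    (enc_matrix
      [seq [:: (vname pad false (false :: pi) a, true),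
             (vname pad true pi (keep a (keep b p)), false) &
             [seq (x, x \in a) | x <- discard S2 b]]
      | a <- subs b & good psi b a])
    (W * mu 14).
Proof.
case=> sz_pi sz_p szp [szb sz_bp]; rewrite -flatten_if.
have sz_b : dsize (enc_pvars b) <= M by lia.
apply: (map_computes_exp (f := 30)) => // [a /dsize_subs sz_a|a _|].
- have {}sz_a := leq_trans sz_a sz_b; have sz_pi6 := path_small6 sz_pi.
  have [sz_q szq] := keep_small b sz_p szp.
  have [sz_r szr] := keep_small a sz_q szq.
  have mu12 := mu_step (isT : 11 < 12); have mu11 := mu_step (isT : 8 < 11).
  have mu8 := mu_step (isT : 2 < 8); have mu2 := mu_gt0 2.
  have [v ev_good] := good_computes sz_b sz_a.
  case: (good psi b a) => [eq_v|[d [d' eq_v]]]; rewrite eq_v in ev_good; last first.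
    by run_body; lia.
  have ev_name1 := name_computes false (child_path_small false sz_pi) sz_a.
  have ev_name3 := name_computes true sz_pi6 sz_r.
  have ev_q := keep_computes sz_b sz_p.
  have ev_r := keep_computes sz_a sz_q.
  have ev_d := discard_computes S2_small sz_b.
  have sz_d : dsize (enc_pvars (discard S2 b)) <= M.
    exact: leq_trans (dsize_subseq _ (filter_subseq _ _)) sz_b.
  have ev_l := lits_of_computes sz_a sz_d.
  by run_body; lia.
- by case: ifP => _; [exact: mu_gt0 | exact: leq0n].
- exact: size_subs20.
Qed.

Lemma terms_computes it : item_small it ->
  computes terms_index (Cons enc_context (enc_item it))
    (enc_matrix (terms pad S2 psi it)) (W * mu 15).
Proof.
move=> it_small; have ev_bag := bag_computes it_small.
have W0 := W_gt0; have sz_bag := size_out_bag_small it_small.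
have ev_dum : computes dummies_index (Cons Nil (enc_pvars (out_bag pad S2 it)))
    (enc_matrix [seq [:: (x, true); (x, false)] | x <- out_bag pad S2 it]) (W * mu 3).
  by apply: dummies_computes; apply: leq_trans sz_bag _; rewrite leq_mul2r orbT.
have mu14 := muW_step (isT : 14 < 15).
have mu11 := muW_step (isT : 11 < 14).
have mu10 := muW_step (isT : 10 < 14).
have mu5 := muW_step (isT : 5 < 14).
have mu3 := muW_step (isT : 3 < 14).
have mu0 := muW0 2.
have ev_app0 l2 := append_computes (enc_seq enc_literal)
  [seq [:: (x, true); (x, false)] | x <- out_bag pad S2 it] l2.
have {}ev_app0 := ev_app0 (local_terms pad S2 psi it).
rewrite size_map in ev_app0.
move: (size (out_bag pad S2 it)) sz_bag ev_app0 => n sz_bag ev_app0.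
case: it it_small ev_bag ev_dum ev_app0 => -[pi p] F it_small ev_bag ev_dum ev_app0.
have [sz_pi sz_p szp szF] := it_small; have ev_subp := subs_computes_small szp.
case: F szF it_small ev_bag ev_dum ev_app0 => [_|b L1 L2 [szb sz_bp]] it_small
  ev_bag ev_dum ev_app0.
  have ev_leaf := leaf_terms_computes it_small.
  by run_body; lia.
have ev_subb := subs_computes_small szb.
have ev_join := join_terms_computes it_small.
have ev_proj := project_terms_computes it_small.
have ev_app1 := append_computes (enc_seq enc_literal)
  [seq [:: (vname pad false (true :: pi) a, true);
             (vname pad true pi (keep a (keep b p)), true);
             (vname pad false pi a, false)] | a <- subs p]
  [seq [:: (vname pad false (false :: pi) a, true),
             (vname pad true pi (keep a (keep b p)), false) &
             [seq (x, x \in a) | x <- discard S2 b]]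
  | a <- subs b & good psi b a].
have szsp := size_subs_small szp.
by run_body; rewrite size_map; lia.
Qed.

Lemma size_terms it : item_small it -> size (terms pad S2 psi it) <= 17 * W.
Proof.
move=> it_small; have W0 := W_gt0; rewrite /terms size_cat size_map.
have := size_out_bag_small it_small; case: it it_small => -[pi p] F [_ _ szp szF].
move: (size (out_bag _ _ _)) => n; have := size_subs_small szp.
case: F szF => [_|b L1 L2 [szb _]] /=; first by rewrite size_map; lia.
rewrite size_cat !size_map size_filter.
set c := count _ _; have : c <= size (subs b) by exact: count_size.
by have := size_subs_small szb; lia.
Qed.

Lemma all_vars_computes its :
  {in its, forall it, item_small it} -> size its <= M ->
  computes all_vars_index (Cons enc_context (enc_seq enc_item its))
    (enc_pvars (flatten (map (own_vars pad) its))) (W * mu 11).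
Proof.
move=> small szits.
apply: (map_computes_items (f := own_index)) => // it /small it_small.
  exact: own_computes.
by apply: leq_trans (size_own it_small) _; have := muW0 8; have := W_gt0; lia.
Qed.

Lemma all_terms_computes its :
  {in its, forall it, item_small it} -> size its <= M ->
  computes all_terms_index (Cons enc_context (enc_seq enc_item its))
    (enc_matrix (flatten (map (terms pad S2 psi) its))) (W * mu 17).
Proof.
move=> small szits.
apply: (map_computes_items (f := terms_index)) => // it /small it_small.
  exact: terms_computes.
by apply: leq_trans (size_terms it_small) _; have := muW0 14; have := W_gt0; lia.
Qed.

Lemma tree_computes pi p F :
  {in items pi p F, forall it, item_small it} ->
  computes tree_index (Cons enc_context (enc_item (pi, p, F)))
    (enc_btree (out_tree pad S2 pi p F)) (size (items pi p F) * (W * mu 11)).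
Proof.
have mu11 := muW_step (isT : 10 < 11); have mu0 := muW0 9; have W0 := W_gt0.
elim: F pi p => [|b L1 IH1 L2 IH2] pi p small;
  have ev_bag := bag_computes (small _ (items_head _ _ _)).
  by run_body; rewrite /=; lia.
have ev1 : computes tree_index (Cons enc_context (enc_item (false :: pi, b, L1)))
    (enc_btree (out_tree pad S2 (false :: pi) b L1))
    (size (items (false :: pi) b L1) * (W * mu 11)).
  by apply: IH1 => it it_in; apply: small; rewrite /= inE mem_cat it_in orbT.
have ev2 : computes tree_index (Cons enc_context (enc_item (true :: pi, p, L2)))
    (enc_btree (out_tree pad S2 (true :: pi) p L2))
    (size (items (true :: pi) p L2) * (W * mu 11)).
  by apply: IH2 => it it_in; apply: small; rewrite /= inE mem_cat it_in !orbT.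
by run_body; rewrite /= size_cat mulSn mulnDl; lia.
Qed.

(** * Size of the output written without sharing *)

Hypothesis pad_small : size pad <= M.

Lemma dsize_own it y :
  item_small it -> y \in own_vars pad it -> dsize (enc_pvar y) <= mu 2.
Proof.
case: it => -[pi p] F [sz_pi sz_p szp _].
suff bound tag a : dsize (enc_pvars a) <= M ->
    dsize (enc_pvar (vname pad tag pi a)) <= mu 2.
  rewrite mem_cat => /orP[/namesP[a /dsize_subs sz_a ->]|].
    by apply: bound; apply: leq_trans sz_a sz_p.
  case: F => // b _ _ /namesP[a /dsize_subs sz_a ->]; apply: bound.
  by have [sz_q _] := keep_small b sz_p szp; apply: leq_trans sz_a sz_q.
move=> sz_a; apply: leq_trans (dsize_enc_pvar _) _.
have := mu_step (isT : 1 < 2); rewrite pw1 size_flat /=.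
by case: tag => /=; lia.
Qed.

Section OutputSize.

Variable F : forest.
Hypothesis small : {in items [::] [::] F, forall it, item_small it}.
Hypothesis items_le : size (items [::] [::] F) <= M.
Hypothesis old_small : {in fvars F, forall x, dsize (enc_pvar x) <= M}.

Lemma dsize_out_bag it y :
  it \in items [::] [::] F -> y \in out_bag pad S2 it -> dsize (enc_pvar y) <= mu 2.
Proof.
move=> it_in y_in; have [|[/old_small y_le _]] := out_bag_bound it_in y_in.
  by case/mem_new_vars=> it' /small; apply: dsize_own.
by apply: leq_trans y_le _; have := mu_step (isT : 1 < 2); rewrite pw1; lia.
Qed.

Lemma size_flatten_items (T : Type) (g : item -> seq T) A :
  {in items [::] [::] F, forall it, size (g it) <= A} ->
  size (flatten (map g (items [::] [::] F))) <= M * A.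
Proof.
move=> le_A; apply: leq_trans (_ : size (items [::] [::] F) * A <= _); last first.
  by rewrite leq_mul2r items_le orbT.
elim: (items _ _ F) le_A => //= it its IH le_A.
rewrite size_cat mulSn leq_add ?le_A ?mem_head // IH // => it' it'_in.
by apply: le_A; rewrite inE it'_in orbT.
Qed.

Lemma dsize_new_vars : dsize (enc_pvars (new_vars pad F)) <= W * mu 5.
Proof.
apply: leq_trans (dsize_enc_seq_le (A := mu 2) _) _.
  by move=> y /mem_new_vars[it /small]; apply: dsize_own.
have sz_nv : size (new_vars pad F) <= M * (4 * W).
  by apply: size_flatten_items => it /small; apply: size_own.
have mu3 := muW_step (isT : 3 < 5); have mu0 := muW0 2.
have eq_mu3 : W * mu 3 = M * (W * mu 2) by rewrite /pw !expnS; lia.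
apply: leq_trans (_ : M * (4 * W) * (2 * mu 2) + 1 <= _).
  by rewrite leq_add2r leq_mul //; have := mu_gt0 2; lia.
by rewrite (_ : M * _ * _ = 8 * (W * mu 3)); [have := W_gt0; lia | rewrite eq_mu3; lia].
Qed.

Lemma size_term t : t \in new_matrix pad S2 psi F -> size t <= M + 2.
Proof.
rewrite inE => /predU1P[-> /=|]; first by lia.
case/flattenP=> _ /mapP[it it_in ->]; rewrite mem_cat => /orP[/mapP[x _ ->] /=|].
  by lia.
have := small it_in; case: it it_in => -[pi p] [|b L1 L2] it_in [_ sz_p szp szF].
  by case/mapP=> a _ -> /=; lia.
have [szb sz_bp] := szF; rewrite mem_cat => /orP[/mapP[a _ ->] /=|]; first by lia.
case/mapP=> a _ -> /=; rewrite size_map addn2 !ltnS.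
apply: leq_trans (size_subseq (filter_subseq _ _)) _.
by apply: leq_trans (size_le_dsize enc_pvar b) _; lia.
Qed.

Lemma dsize_new_matrix : dsize (enc_matrix (new_matrix pad S2 psi F)) <= W * mu 7.
Proof.
have mu3 := mu_step (isT : 3 < 4); have mu2 := mu_step (isT : 2 < 4).
have mu1 := mu_step (isT : 1 < 4); rewrite pw1 in mu1; have mu2_0 := mu_gt0 2.
apply: leq_trans (dsize_enc_seq_le (A := mu 4) _) _ => [t t_in|].
  apply: leq_trans (dsize_enc_seq_le (A := 5 + mu 2) _) _ => [l l_in|].
    have [it it_in sub] := term_in_bag t_in.
    have /(dsize_out_bag it_in) := sub l.1 (map_f fst l_in).
    rewrite -[dsize (enc_literal l)]/((dsize (enc_pvar l.1) + dsize (enc_bool l.2)).+1).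
    have : dsize (enc_bool l.2) <= 3 by case: (l.2).
    by move: (dsize _) (dsize _) => m n; lia.
  have eq_mu3 : mu 3 = M * mu 2 by rewrite /pw !expnS.
  apply: leq_trans (_ : (M + 2) * (6 + mu 2) + 1 <= _).
    by rewrite leq_add2r leq_mul2r size_term ?orbT.
  by rewrite mulnDl !mulnDr -eq_mu3; lia.
have sz_M : size (flatten (map (terms pad S2 psi) (items [::] [::] F))) <= M * (17 * W).
  by apply: size_flatten_items => it /small; apply: size_terms.
have mu5 := muW_step (isT : 5 < 7); have mu4 := muW_step (isT : 4 < 5).
have eq_mu5 : W * mu 5 = M * (W * mu 4) by rewrite /pw !expnS; lia.
have mu4W := mu_muW 4; have mu4_0 := mu_gt0 4.
apply: leq_trans (_ : (M * (17 * W)).+1 * (2 * mu 4) + 1 <= _).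
  by rewrite leq_add2r leq_mul //; lia.
rewrite mulSn (_ : M * _ * _ = 34 * (W * mu 5)); first lia.
by rewrite eq_mu5; lia.
Qed.

Lemma dsize_out_tree :
  dsize (enc_btree (out_tree pad S2 [::] [::] F)) <= W * mu 6.
Proof.
(* The additional 4 pays for a node and the list of its two subtrees. *)
have bag_le it : it \in items [::] [::] F ->
    dsize (enc_pvars (out_bag pad S2 it)) + 4 <= W * mu 3.
  move=> it_in; have mu3 := muW_step (isT : 2 < 3); have mu0 := muW0 1.
  have sz := size_out_bag_small (small it_in); have mu2 := mu_gt0 2.
  have le1 := dsize_enc_seq_le (fun y => @dsize_out_bag it y it_in).
  have le2 : size (out_bag pad S2 it) * (mu 2).+1 <= 13 * W * (2 * mu 2).
    by rewrite leq_mul //; lia.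
  move: {le1 le2}(leq_trans le1 (leq_add le2 (leqnn 1))); have := W_gt0.
  by move: (dsize _) => n; lia.
suff le_tree pi p G : {subset items pi p G <= items [::] [::] F} ->
    dsize (enc_btree (out_tree pad S2 pi p G)) <= size (items pi p G) * (W * mu 3).
  apply: leq_trans (le_tree _ _ _ (fun _ => id)) _.
  apply: leq_trans (_ : M * (W * mu 3) <= _); first by rewrite leq_mul2r items_le orbT.
  rewrite (_ : M * _ = W * mu 4); last by rewrite /pw !expnS; lia.
  by have := muW_step (isT : 4 < 6); lia.
elim: G pi p => [|b L1 IH1 L2 IH2] pi p sub;
  have := bag_le _ (sub _ (items_head _ _ _)); rewrite [size _]/=.
  by rewrite /=; lia.
have := IH1 (false :: pi) b; have := IH2 (true :: pi) p.
move=> /(_ _)/wrap[|le2] => [it it_in|].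
  by apply: sub; rewrite /= inE mem_cat it_in !orbT.
move=> /(_ _)/wrap[|le1] => [it it_in|].
  by apply: sub; rewrite /= inE mem_cat it_in orbT.
by rewrite size_cat mulSn mulnDl /= => le_bag; lia.
Qed.

End OutputSize.

End Costs.

Lemma size_items_le pi p F : size (items pi p F) <= dsize (enc_forest F).
Proof.
elim: F pi p => //= b L1 IH1 L2 IH2 pi p; rewrite size_cat.
by have := IH1 (false :: pi) b; have := IH2 (true :: pi) p; lia.
Qed.

Lemma size_path_le pi p F it :
  it \in items pi p F -> size it.1.1 <= size pi + size (items pi p F).
Proof.
elim: F pi p => [|b L1 IH1 L2 IH2] pi p /=.
  by rewrite inE => /eqP-> /=; lia.
rewrite inE mem_cat size_cat => /or3P[/eqP->|/IH1|/IH2] /=; lia.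
Qed.

Lemma dsize_fbags F b :
  b \in fbags F -> dsize (enc_seq enc_pvar b) <= dsize (enc_forest F).
Proof.
elim: F => //= b' L1 IH1 L2 IH2; rewrite inE mem_cat.
by case/or3P=> [/eqP->|/IH1|/IH2]; lia.
Qed.

Lemma dsize_bound_vars P x :
  x \in bound_vars P -> dsize (enc_pvar x) <= dsize (enc_seq enc_block P).
Proof.
elim: P => //= -[q X] P IH; rewrite /bound_vars /= mem_cat => /orP[x_in|/IH]; last lia.
apply: leq_trans (dsize_mem enc_pvar x_in) _; apply: leqW.
by apply: leq_trans (leq_addr _ _); apply: leqW; apply: leq_addl.
Qed.

Lemma items_small M k F :
  500 <= M -> {in fbags F, forall b, size b <= k.+1} -> 2 * dsize (enc_forest F) <= M ->
  {in items [::] [::] F, forall it, item_small M k it}.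
Proof.
move=> M_large szF dF [[pi p] G] it_in.
have [p_in b_in] := items_bag it_in; have /= sz_pi := size_path_le it_in.
have sz_its := size_items_le [::] [::] F; have dpi := dsize_enc_pvar pi.
have [dp szp] : dsize (enc_seq enc_pvar p) <= dsize (enc_forest F) /\ size p <= k.+1.
  case: p_in => /= [->|p_in]; last by split; [apply: dsize_fbags | apply: szF].
  by case: (F).
split=> //; try lia.
case: G b_in {it_in p_in} => // b _ _ /= b_in; split; first exact: szF.
by have := dsize_fbags b_in; lia.
Qed.

(** * Total running time on a given input *)

Section Main.

Variables (outer : seq block) (S1 S2 : seq pvar) (psi : matrix) (D : btree).

Let phi := Qbf (outer ++ [:: (All, S1); (Ex, S2)]) psi.
Let F := lcrs D Leaf.
Let N := dsize (encode phi D).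
(** The factor 2 accommodates the two bags of an item together, and 500 dominates the constants of
    the program. *)
Let M := 2 * N + 500.
Let k := width D.
(** The serialised input is at least as long as every name it contains, and one linear traversal
    computes it. *)
Let pad := flat (encode phi D) [::].
Let phi' := Qbf (outer ++ [:: (All, S1 ++ new_vars pad F)]) (new_matrix pad S2 psi F).
Let D' := out_tree pad S2 [::] [::] F.

Lemma reduction_sizes :
  [/\ dsize (enc_seq enc_block (Defs.prefix phi)) <= N, dsize (enc_matrix psi) <= N,
      dsize (enc_forest F) <= N & dsize (enc_btree D) <= N].
Proof.
by rewrite /F enc_forest_lcrs /N /encode /enc_qbf /=; split; lia.
Qed.

Lemma reduction_block_sizes :
  [/\ size outer <= N, size S1 <= N & dsize (enc_seq enc_pvar S2) <= N].
Proof.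
have [le_N _ _ _] := reduction_sizes.
have : size outer + dsize (enc_seq enc_pvar S1) + dsize (enc_seq enc_pvar S2) <=
    dsize (enc_seq enc_block (Defs.prefix phi)).
  by rewrite /phi /=; elim: (outer) => [|B l IH] /=; lia.
have := size_le_dsize enc_pvar S1.
by move: (size S1) => n; split; lia.
Qed.

Lemma width_bags : {in fbags F, forall b, size b <= k.+1}.
Proof.
move=> b; rewrite fbags_lcrs cats0 => b_in.
apply: leq_trans (leqSpred _); exact: (@leq_bigmax_seq _ _ xpredT size).
Qed.

Lemma M_large : 500 <= M. Proof. exact: leq_addl. Qed.

Lemma reduction_items_small : {in items [::] [::] F, forall it, item_small M k it}.
Proof.
apply: items_small M_large width_bags _.
by have [_ _ le_N _] := reduction_sizes; rewrite /M; lia.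
Qed.

Lemma size_items_M : size (items [::] [::] F) <= M.
Proof.
have [_ _ le_N _] := reduction_sizes.
by have := size_items_le [::] [::] F; rewrite /M; lia.
Qed.

Lemma main_computes : computes 0 (encode phi D) (encode phi' D') (2 ^ k * pw M 18).
Proof.
have [dP dpsi dF dD] := reduction_sizes.
have [sz_outer szS1 dS2] := reduction_block_sizes.
have small := reduction_items_small; have szits := size_items_M; have M500 := M_large.
have psi_M : dsize (enc_matrix psi) <= M by rewrite /M; lia.
have S2_M : dsize (enc_seq enc_pvar S2) <= M by rewrite /M; lia.
have ev_flat : computes flat_index (Cons (encode phi D) Nil) (enc_pvar pad) (40 * N).
  exact: (flat_computes (encode phi D) [::]).
have ev_last := last_computes outer All Ex S1 S2.
have ev_items := items_computes [::] [::] F.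
have ev_tree := tree_computes pad M500 S2_M psi_M small.
have ev_vars := all_vars_computes pad M500 S2_M psi_M small szits.
have ev_terms := all_terms_computes pad M500 S2_M psi_M small szits.
have ev_prefix := prefix_computes outer All Ex S1 S2 (new_vars pad F).
have ev_name : computes name_index
    (Cons (Cons (enc_pvar pad) (Cons (enc_bool false) (enc_pvar [::])))
          (enc_seq enc_pvar [::]))
    (enc_pvar (vname pad false [::] [::])) (pw M 2).
  by apply: (name_computes pad M500 S2_M psi_M); rewrite /=; lia.
have eq_root : enc_item ([::], [::], F) = Cons (Cons Nil Nil) (Cons (enc_btree D) Nil).
  by rewrite /enc_item enc_forest_lcrs.
rewrite eq_root in ev_items ev_tree.
have le_n2 : size (items [::] [::] F) ^ 2 <= pw M 2 by rewrite leq_exp2r.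
have le_n12 : size (items [::] [::] F) * (2 ^ k * pw M 11) <= 2 ^ k * pw M 12.
  rewrite (_ : 2 ^ k * pw M 12 = M * (2 ^ k * pw M 11)) ?leq_mul2r ?szits ?orbT //.
  by rewrite /pw expnS mulnCA.
run_body.
have le_NM : N <= M by rewrite /M; lia.
have le1 : 500 * M <= pw M 2 by rewrite -{1}(pw1 M); apply: mu_step.
have le2 := mu_step M500 (isT : 2 < 11); have leW := mu_muW M k 11.
have le11 := muW_step k M500 (isT : 11 < 17).
have le12 := muW_step k M500 (isT : 12 < 17).
have le17 := muW_step k M500 (isT : 17 < 18).
move: (size outer) (size S1) sz_outer szS1 => n1 n2 le_n1 le_n2'.
move: (size (items _ _ _) ^ 2) (size (items _ _ _) * _) le_n2 le_n12 => A1 A2 le_A1 le_A2.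
clearbody M; lia.
Qed.

Lemma output_size : dsize (encode phi' D') <= 2 ^ k * pw M 18.
Proof.
have [dP dpsi dF dD] := reduction_sizes.
have [sz_outer szS1 dS2] := reduction_block_sizes.
have small := reduction_items_small; have szits := size_items_M; have M500 := M_large.
have psi_M : dsize (enc_matrix psi) <= M by rewrite /M; lia.
have S2_M : dsize (enc_seq enc_pvar S2) <= M by rewrite /M; lia.
have pad_M : size pad <= M by rewrite /pad size_flat /M -/N /=; lia.
have old_M : {in fvars F, forall x, dsize (enc_pvar x) <= M}.
  move=> x /fvarsP[b b_in x_in]; apply: leq_trans (dsize_mem enc_pvar x_in) _.
  by apply: leq_trans (dsize_fbags b_in) _; rewrite /M; lia.
have dvars := dsize_new_vars M500 S2_M psi_M pad_M small szits.
have dmat := dsize_new_matrix M500 S2_M psi_M pad_M small szits old_M.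
have dtree := dsize_out_tree M500 S2_M psi_M pad_M small szits old_M.
have dprefix : dsize (enc_seq enc_block (Defs.prefix phi')) <=
    dsize (enc_seq enc_block (Defs.prefix phi)) +
    dsize (enc_seq enc_pvar (new_vars pad F)).
  rewrite /=; have := dsize_cat enc_pvar S1 (new_vars pad F).
  by elim: (outer) => [|B l IH] /=; lia.
have -> : dsize (encode phi' D') =
    (dsize (enc_seq enc_block (Defs.prefix phi')) +
     dsize (enc_matrix (new_matrix pad S2 psi F))).+1 + dsize (enc_btree D') + 1.
  by rewrite addn1.
have le_NM : N <= M by rewrite /M; lia.
have le1 : 500 * M <= pw M 2 by rewrite -{1}(pw1 M); apply: mu_step.
have leW := mu_muW M k 2; have le2 := muW_step k M500 (isT : 2 < 18).
have le5 := muW_step k M500 (isT : 5 < 18); have le6 := muW_step k M500 (isT : 6 < 18).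
have le7 := muW_step k M500 (isT : 7 < 18).
move: (leq_trans dprefix (leq_add (leq_trans dP le_NM) dvars)) dmat dtree.
move: (dsize (enc_seq enc_block _)) (dsize (enc_matrix _)) (dsize (enc_btree _)).
clearbody M; lia.
Qed.

Lemma reduction_in_time :
  exists2 t, outputs_in_time reduction_program (encode phi D) (encode phi' D') t
    & t <= 2 ^ k * pw M 19.
Proof.
have [s le_s ev_s] := main_computes; exists (s + dsize (encode phi' D')).
  by exists s.
have := output_size; have := muW_step k M_large (isT : 18 < 19).
by clearbody M; move: (dsize _) => n; lia.
Qed.

Lemma pad_long : {in bound_vars (Defs.prefix phi), forall x, size x <= size pad}.
Proof.
have [dP _ _ _] := reduction_sizes.
move=> x /dsize_bound_vars dx; rewrite /pad size_flat addn0.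
apply: leq_trans (size_le_dsize enc_bool x) _; exact: leq_trans dx dP.
Qed.

End Main.

Lemma scale_bound w n m q d : m <= q * n -> w * pw m d <= q ^ d * w * n ^ d.
Proof.
move=> le_m; rewrite (mulnC (q ^ d)) -mulnA -expnMn leq_mul2l.
by case: d => [|d]; rewrite ?expn0 ?orbT // leq_exp2r ?le_m ?orbT.
Qed.

Theorem lemma9 :
  exists (P : program) (c d : nat),
  forall (outer : seq block) (S1 S2 : seq pvar) (psi : matrix)
         (D : btree) (k : nat),
  let phi := Qbf (outer ++ [:: (All, S1); (Ex, S2)]) psi in
  wf_qbf phi ->
  tree_decomposition_of phi D ->
  width D = k ->
  exists (S1' : seq pvar) (psi' : matrix) (D' : btree) (t : nat),
  let phi' := Qbf (outer ++ [:: (All, S1')]) psi' in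
  [/\ outputs_in_time P (encode phi D) (encode phi' D') t,
      t <= c * 2 ^ k * dsize (encode phi D) ^ d,
      wf_qbf phi',
      tree_decomposition_of phi' D' /\ width D' <= 12 * 2 ^ k
    & valid phi <-> valid phi'].
Proof.
(* For an input of size [N], which is positive, [2 * N + 500 <= 502 * N]. The exponent 19 is 18 for
   the evaluation and for the output, plus one to absorb their sum. *)
pose q := 502; exists reduction_program, (q ^ 19), 19.
move=> outer S1 S2 psi D k phi wf_phi dec_phi <-.
pose pad := flat (encode phi D) [::]; pose F := lcrs D Leaf.
have long : {in bound_vars (Defs.prefix phi), forall x, size x <= size pad}.
  exact: pad_long.
have [t out_t le_t] := reduction_in_time outer S1 S2 psi D.
exists (S1 ++ new_vars pad F), (new_matrix pad S2 psi F).
exists (out_tree pad S2 [::] [::] F), t; split.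
- exact: out_t.
- apply: leq_trans le_t _; apply: scale_bound; rewrite -/phi.
  have : 0 < dsize (encode phi D) by [].
  by rewrite /q; lia.
- exact: reduction_wf wf_phi dec_phi long.
- split; first exact: reduction_decomposition wf_phi dec_phi long.
  exact: reduction_width.
- exact: reduction_valid wf_phi dec_phi long.
Qed.
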